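(* Let $\alpha\in\mathbb{R}$, $N\ge2$, $\mathbf{y}_1,\dots,\mathbf{y}_{N-2}\in\mathbb{R}^2$ arbitrary, $0\le R\le L/6$ with $L>0$, $\kappa\in[0,1]$, and $u\in W^{1,2}([R,L],r\,dr)$. Then $$\int_R^L\Big(|u'|^2+\frac{\rho(r)}{r^2}|u|^2\Big)r\,dr\ge\int_R^L\Big((1-\kappa)|u'|^2+c(\kappa)^2\frac{\alpha_N^2}{r^2}\mathbb{1}_{[3R,L-3R]}(r)|u|^2\Big)r\,dr$$ with $c(\kappa)=4.7\cdot10^{-4}\,\kappa/(1+2\kappa)$. In the case $R=0$ one may take $c(\kappa)\equiv1$.
   Context: For $R>0$ define the normalized flux $\hat\Phi(r)=\alpha\Big(\int_{B_r(0)}\frac{\mathbb{1}_{B_{R/2}(0)}}{\pi(R/2)^2}+2\sum_{l=1}^{N-2}\int_{B_r(0)}\frac{\mathbb{1}_{B_R(\mathbf{y}_l)}}{\pi R^2}\Big)$; for $R=0$ (point fluxes) $\hat\Phi(r)=\alpha\big(1+2\#\{l:|\mathbf{y}_l|<r\}\big)$. Then $\rho(r):=\inf_{q\in\mathbb{Z}}|\hat\Phi(r)-2q|^2$. Also $\alpha_N:=\min_{p\in\{0,\dots,N-2\}}\min_{q\in\mathbb{Z}}|(2p+1)\alpha-2q|$. $B_r(\mathbf{y})$ is the open disk. *)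

(* Defs.v *)
From HB Require Import structures.
From mathcomp Require Import all_boot all_order all_algebra.
From mathcomp Require Import all_classical all_reals all_analysis.
Set Implicit Arguments. Unset Strict Implicit. Unset Printing Implicit Defensive.
Import Order.TTheory GRing.Theory Num.Theory.
Import numFieldNormedType.Exports.
Local Open Scope classical_set_scope.
Local Open Scope ring_scope.

Section Defs.
Variable R : realType.

Definition leb1 := (@lebesgue_measure R).

Definition leb2 := (leb1 \x leb1)%E.

Definition disk (y : R * R) (r : R) : set (R * R) :=
  [set p | (p.1 - y.1) ^+ 2 + (p.2 - y.2) ^+ 2 < r ^+ 2 /\ 0 < r].

Definition area (A : set (R * R)) : R := fine (leb2 A).

Definition origin : R * R := (0, 0).

Definition Phihat (alpha Rr : R) (N : nat) (y : 'I_(N - 2) -> R * R) (r : R) : R :=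
  if Rr == 0 then
    alpha * (1 + 2 * (#|[set l : 'I_(N - 2) | `[< disk origin r (y l) >] ]|)%:R)
  else
    alpha * (area (disk origin r `&` disk origin (Rr / 2)) / (pi * (Rr / 2) ^+ 2)
             + 2 * \sum_(l < N - 2) area (disk origin r `&` disk (y l) Rr) / (pi * Rr ^+ 2)).

Definition rho (alpha Rr : R) (N : nat) (y : 'I_(N - 2) -> R * R) (r : R) : R :=
  inf [set `|Phihat alpha Rr y r - 2 * q%:~R| ^+ 2 | q in [set: int]].

Definition alphaN (alpha : R) (N : nat) : R :=
  inf [set inf [set `|(2 * p + 1)%:R * alpha - 2 * q%:~R| | q in [set: int]]
      | p in [set p : nat | (p <= N - 2)%N]].

Definition test_fun (a b : R) (phi : R -> R) : Prop :=
  (forall x, derivable phi x 1) /\ continuous (derive1 phi) /\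
  exists c d, a < c /\ d < b /\ forall x, x < c \/ d < x -> phi x = 0.

Definition weak_deriv (a b : R) (u g : R -> R) : Prop :=
  (forall c d, a < c -> d < b ->
     leb1.-integrable `[c, d] (EFin \o u) /\ leb1.-integrable `[c, d] (EFin \o g)) /\
  forall phi, test_fun a b phi ->
    (\int[leb1]_(x in `]a, b[) (u x * derive1 phi x)%:E =
     - \int[leb1]_(x in `]a, b[) (g x * phi x)%:E)%E.

Definition W12r (a b : R) (u du : R -> R) : Prop :=
  weak_deriv a b u du /\
  (\int[leb1]_(x in `[a, b]) ((u x) ^+ 2 * x)%:E < +oo)%E /\
  (\int[leb1]_(x in `[a, b]) ((du x) ^+ 2 * x)%:E < +oo)%E.

Definition ckappa (kappa : R) : R := (47 / 10 ^+ 5) * kappa / (1 + 2 * kappa).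

(* LHS and RHS of the inequality, for complex u = u1 + i u2 with u' = du1 + i du2 *)
Definition lhs (alpha Rr L : R) (N : nat) (y : 'I_(N - 2) -> R * R)
    (u1 u2 du1 du2 : R -> R) : \bar R :=
  \int[leb1]_(r in `[Rr, L])
    (((du1 r) ^+ 2 + (du2 r) ^+ 2
      + rho alpha Rr y r / r ^+ 2 * ((u1 r) ^+ 2 + (u2 r) ^+ 2)) * r)%:E.

Definition rhs (alpha Rr L kappa c : R) (N : nat) (u1 u2 du1 du2 : R -> R) : \bar R :=
  \int[leb1]_(r in `[Rr, L])
    (((1 - kappa) * ((du1 r) ^+ 2 + (du2 r) ^+ 2)
      + c ^+ 2 * (alphaN alpha N) ^+ 2 / r ^+ 2 * \1_(`[3 * Rr, L - 3 * Rr]) r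
        * ((u1 r) ^+ 2 + (u2 r) ^+ 2)) * r)%:E.

End Defs.

(* Main.v *)
(* For R = 0 the normalized flux is an odd multiple of alpha, so rho >= alphaN^2 pointwise.

For R > 0 and r >= 3R the flux is alpha (1 + 2F), F being the sum of the covered fractions of the
disks. Cut [3R, L - 3R] into cells of length R/2. Slicing the disks by lines through their center
parallel to the radius shows that on a cell each covered fraction grows at a rate that is
increasing, or decreasing, up to a constant factor. Hence, on one side of the cell, so does F: the
time that alpha (1 + 2F) spends within alphaN/640 of an even integer is controlled by the time it
spends at distance between alphaN/640 and 3 alphaN/640 just before (or after), unless F barely
grows, in which case no disk is cut, F is an integer, and the flux is an odd multiple of alpha. So
rho >= (alphaN/640)^2 on a fixed proportion of each cell, and a Poincare inequality on the cell
transfers this lower bound to the whole cell at the cost of a fraction of the gradient term. *)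

Require Import Defs.
From HB Require Import structures.
From mathcomp Require Import all_boot all_order all_algebra.
From mathcomp Require Import all_classical all_reals all_analysis.
From mathcomp Require Import measurable_realfun ring lra.
Set Implicit Arguments. Unset Strict Implicit. Unset Printing Implicit Defensive.
Import Order.TTheory GRing.Theory Num.Theory.
Import numFieldNormedType.Exports.
Local Open Scope classical_set_scope.
Local Open Scope ring_scope.

(** * Rotation invariance of planar area *)

Section Plane.
Variable R : realType.
Local Notation leb1 := (@leb1 R).
Local Notation leb2 := (@leb2 R).

(** The constants must depend neither on the number of disks nor on their positions. Comparisons of
    average slopes survive summation over the disks, which is why growth is expressed through them.
    The growth rate of one disk, with center at distance [t] and radius [q], rises (up to a factor)
    until the circle about the origin passes through the ends of the diameter orthogonal to the
    radius, at radius [sqrt (t^2 + q^2)], and falls afterwards. Cells are so short that a disk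
    turning inside a cell grows there at a rate constant up to a factor 11/5. A sum of rising and
    falling rates is neither; comparing the two kinds on a short gap in the middle of the cell
    decides which half to use. The number 640 arises because a cut disk adds at least 1/320 to F
    over a short window, so the flux changes by at least [|alpha| / 160 >= 4 delta] with
    [delta = alphaN / 640]; this is what it takes to traverse a full band at distance between
    [delta] and [3 delta] from an even integer. The prescribed value of c(kappa) leaves only a few
    percent of slack in the final count. *)

Lemma leb1_translate (c : R) (A : set R) : measurable A ->
  leb1 ((fun x => x + c) @^-1` A) = leb1 A.
Proof.
move=> mA.
have mf : measurable_fun setT ((fun x : R => x + c) : measurableTypeR R -> measurableTypeR R).
  by apply: measurable_funD.
have := @lebesgue_measure_unique R (pushforward (@lebesgue_measure R : {measure set (measurableTypeR R) -> \bar R}) ((fun x => x + c) : measurableTypeR R -> measurableTypeR R)).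
move=> /(_ mf) h.
rewrite /Defs.leb1; apply/esym; apply: h => // _ [[a b]] _ <-.
have E : (fun x => x + c) @^-1` `]a, b]%classic = `]a - c, b - c]%classic.
  by apply/seteqP; split => x /=; rewrite !in_itv/= => /andP[? ?]; lra.
transitivity (@lebesgue_measure R `]a - c, b - c]%classic); last by rewrite -E.
rewrite !lebesgue_measure_itv/= !lte_fin ltrD2r; case: ifP => // _.
by congr (_%:E); lra.
Qed.

(** A rotation is a product of three shears, and a shear only translates slices; rotation invariance
    of area thus reduces to translation invariance on the line. *)
Definition shearY (k : R) (p : R * R) : R * R := (p.1, p.2 + k * p.1).
Definition shearX (k : R) (p : R * R) : R * R := (p.1 + k * p.2, p.2).

Lemma measurable_shearY k : measurable_fun setT (shearY k).
Proof.
apply: measurable_fun_pair => //=.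
by apply: measurable_funD => //; apply: measurable_funM.
Qed.

Lemma measurable_shearX k : measurable_fun setT (shearX k).
Proof.
apply: measurable_fun_pair => //=.
by apply: measurable_funD => //; apply: measurable_funM.
Qed.

Lemma leb2_shearY k (A : set (R * R)) : measurable A -> leb2 (shearY k @^-1` A) = leb2 A.
Proof.
move=> mA; rewrite /leb2 /product_measure1; apply: eq_integral => x _ /=.
rewrite -(@leb1_translate (k * x) (xsection A x)); last exact: measurable_xsection.
by congr (leb1 _); apply/seteqP; split => y /=; rewrite /xsection /= ?inE.
Qed.

(** [leb2] integrates vertical slices, whereas a horizontal shear translates the horizontal ones;
    uniqueness of the product measure exchanges the order of slicing. *)
Lemma leb2E_ysection (A : set (R * R)) : measurable A ->
  leb2 A = (\int[leb1]_y leb1 (ysection A y))%E.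
Proof.
move=> mA.
exact: (@product_measure_unique _ _ _ _ R (@lebesgue_measure R) (@lebesgue_measure R)
  (@lebesgue_measure R \x^ @lebesgue_measure R)%E (fun A B mA mB => @product_measure2E _ _ _ _ R
  (@lebesgue_measure R) (@lebesgue_measure R) A B mA mB)).
Qed.

Lemma leb2_shearX k (A : set (R * R)) : measurable A -> leb2 (shearX k @^-1` A) = leb2 A.
Proof.
move=> mA; rewrite !leb2E_ysection //; last first.
  by rewrite -[X in measurable X]setTI; exact: measurable_shearX.
apply: eq_integral => x _ /=.
rewrite -(@leb1_translate (k * x) (ysection A x)); last exact: measurable_ysection.
by congr (leb1 _); apply/seteqP; split => y /=; rewrite /ysection /= ?inE.
Qed.


Definition rotation (c s : R) (p : R * R) : R * R := (c * p.1 - s * p.2, s * p.1 + c * p.2).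

(** The outer shear factor is minus the tangent of half the angle, which blows up at the half turn;
    a nonnegative cosine keeps [1 + c] away from 0. *)
Lemma rotation_shear c s : c ^+ 2 + s ^+ 2 = 1 -> 0 <= c ->
  rotation c s = shearX (- s / (1 + c)) \o shearY s \o shearX (- s / (1 + c)).
Proof.
move=> cs c0; apply/funext => -[x y]; rewrite /rotation /shearX /shearY /=.
have c1 : 1 + c != 0 by lra.
have ks : - s / (1 + c) * s = c - 1.
  apply: (mulIf c1); rewrite mulrAC divfK //.
  have -> : (c - 1) * (1 + c) = c ^+ 2 - 1 by ring.
  by rewrite -cs; ring.
have kc : - s / (1 + c) * (1 + c) = - s by rewrite divfK.
set k := - s / (1 + c) in ks kc *.
have -> : s * (x + k * y) = s * x + (k * s) * y by ring.
rewrite ks; congr (_, _); last ring.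
transitivity ((1 + k * s) * x + k * (1 + c) * y); first by rewrite ks kc; ring.
by ring.
Qed.

Lemma measurable_rotation c s : measurable_fun setT (rotation c s).
Proof.
apply: measurable_fun_pair => /=.
  by apply: measurable_funB => //; apply: measurable_funM.
by apply: measurable_funD => //; apply: measurable_funM.
Qed.

Lemma measurable_preimage (f : R * R -> R * R) (A : set (R * R)) :
  measurable_fun setT f -> measurable A -> measurable (f @^-1` A).
Proof. by move=> mf mA; rewrite -[X in measurable X]setTI; exact: mf. Qed.

Lemma leb2_rotation_ge0 c s A : c ^+ 2 + s ^+ 2 = 1 -> 0 <= c -> measurable A ->
  leb2 (rotation c s @^-1` A) = leb2 A.
Proof.
move=> cs c0 mA; rewrite rotation_shear // !comp_preimage.
have mX k := measurable_shearX k; have mY k := measurable_shearY k.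
rewrite leb2_shearX ?leb2_shearY ?leb2_shearX //.
  exact: measurable_preimage.
by do 2! apply: measurable_preimage => //.
Qed.

Lemma leb2_rotation c s A : c ^+ 2 + s ^+ 2 = 1 -> measurable A ->
  leb2 (rotation c s @^-1` A) = leb2 A.
Proof.
move=> cs mA; have [c0|c0] := leP 0 c; first exact: leb2_rotation_ge0.
(* A half turn makes the cosine positive. It is taken as two quarter turns because its own cosine is
   negative. *)
have E : rotation c s = rotation 0 1 \o rotation 0 1 \o rotation (- c) (- s).
  by apply/funext => -[x y]; rewrite /rotation /=; congr (_, _); ring.
have m01 := measurable_rotation 0 1.
rewrite E !comp_preimage leb2_rotation_ge0 ?sqrrN//; last first.
- by do 2! apply: measurable_preimage => //.
- by rewrite oppr_ge0 ltW.
rewrite !leb2_rotation_ge0 //; try by rewrite expr0n expr1n add0r.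
exact: measurable_preimage.
Qed.

(** Closed inside and open outside, the annulus is, for [0 < r1], exactly the difference of the open
    disks of radii [r2] and [r1] about the origin. *)
Definition piece (q : R) (y : R * R) (r1 r2 : R) : set (R * R) :=
  [set p | (p.1 - y.1) ^+ 2 + (p.2 - y.2) ^+ 2 < q ^+ 2 /\
           r1 ^+ 2 <= p.1 ^+ 2 + p.2 ^+ 2 < r2 ^+ 2].

Lemma measurable_disk (y : R * R) r : measurable (disk y r).
Proof.
have [r0|r0] := ltP 0 r; last first.
  rewrite (_ : disk y r = set0) // -subset0 => p [_]; lra.
rewrite (_ : disk y r = [set: R * R] `&` (fun p => (p.1 - y.1) ^+ 2 + (p.2 - y.2) ^+ 2) @^-1` `]-oo, r ^+ 2[%classic).
  have : measurable_fun setT (fun p : R * R => (p.1 - y.1) ^+ 2 + (p.2 - y.2) ^+ 2).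
    by apply: measurable_funD => //; apply: measurable_funX; exact: measurable_funB.
  by apply=> //; exact: measurable_itv.
by rewrite setTI; apply/seteqP; split => p /=; rewrite in_itv/=; [case|].
Qed.

Lemma measurable_piece q y r1 r2 : measurable (piece q y r1 r2).
Proof.
rewrite (_ : piece q y r1 r2 =
  ([set: R * R] `&` (fun p => (p.1 - y.1) ^+ 2 + (p.2 - y.2) ^+ 2) @^-1` `]-oo, q ^+ 2[%classic) `&`
  ([set: R * R] `&` (fun p => p.1 ^+ 2 + p.2 ^+ 2) @^-1` `[r1 ^+ 2, r2 ^+ 2[%classic)).
  apply: measurableI.
    have : measurable_fun setT (fun p : R * R => (p.1 - y.1) ^+ 2 + (p.2 - y.2) ^+ 2).
      by apply: measurable_funD => //; apply: measurable_funX; exact: measurable_funB.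
    by apply=> //; exact: measurable_itv.
  have : measurable_fun setT (fun p : R * R => p.1 ^+ 2 + p.2 ^+ 2).
    by apply: measurable_funD => //; apply: measurable_funX.
  by apply=> //; exact: measurable_itv.
by rewrite !setTI; apply/seteqP; split => p /=; rewrite !in_itv/=.
Qed.

Definition enorm (y : R * R) := Num.sqrt (y.1 ^+ 2 + y.2 ^+ 2).

Lemma sqr_enorm y : enorm y ^+ 2 = y.1 ^+ 2 + y.2 ^+ 2.
Proof. by rewrite sqr_sqrtr // addr_ge0 ?sqr_ge0. Qed.

(** With the center on the second axis, the slices that define [leb2] are parallel to the radius
    through the center. *)
Lemma leb2_piece q y r1 r2 : leb2 (piece q y r1 r2) = leb2 (piece q (0, enorm y) r1 r2).
Proof.
have t2 := sqr_enorm y.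
have [t0|t0] := eqVneq (enorm y) 0.
  rewrite t0; suff -> : y = (0, 0) by [].
  rewrite t0 expr0n /= in t2; case: y t2 {t0} => y1 y2 /= t2.
  have /andP[/eqP h1 /eqP h2] : (y1 ^+ 2 == 0) && (y2 ^+ 2 == 0).
    by rewrite -paddr_eq0 ?sqr_ge0 // -t2.
  by move/eqP: h1; move/eqP: h2; rewrite !sqrf_eq0 => /eqP -> /eqP ->.
set t := enorm y in t2 t0 *.
(* Cosine and sine of the rotation that takes [y] to [(0, t)]. *)
have cs : (y.2 / t) ^+ 2 + (y.1 / t) ^+ 2 = 1.
  rewrite !expr_div_n -mulrDl addrC -t2 divff // sqrf_eq0; exact: t0.
rewrite -[RHS](leb2_rotation cs); last exact: measurable_piece.
have tc : y.2 / t * t = y.2 by rewrite divfK.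
have ts : y.1 / t * t = y.1 by rewrite divfK.
set c := y.2 / t in cs tc *; set s := y.1 / t in cs ts *.
have E1 p : (rotation c s p).1 ^+ 2 + (rotation c s p).2 ^+ 2 = p.1 ^+ 2 + p.2 ^+ 2.
  rewrite /rotation /=; transitivity ((c ^+ 2 + s ^+ 2) * (p.1 ^+ 2 + p.2 ^+ 2)); first ring.
  by rewrite cs mul1r.
have E2 p : ((rotation c s p).1 - 0) ^+ 2 + ((rotation c s p).2 - t) ^+ 2
    = (p.1 - y.1) ^+ 2 + (p.2 - y.2) ^+ 2.
  transitivity ((rotation c s p).1 ^+ 2 + (rotation c s p).2 ^+ 2
    - 2 * ((s * t) * p.1 + (c * t) * p.2) + t ^+ 2); first by rewrite /rotation /=; ring.
  by rewrite E1 tc ts t2; ring.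
suff -> : rotation c s @^-1` piece q (0, t) r1 r2 = piece q y r1 r2 by [].
by apply/seteqP; split => p; rewrite /piece /= ?E1 ?E2.
Qed.
End Plane.

(** * Slices of the part of a disk that lies in an annulus *)

Section Slices.
Variable R : realType.
Local Notation leb1 := (@leb1 R).
Local Notation leb2 := (@leb2 R).

Lemma leb1_itv_co (a b : R) : a <= b -> leb1 `[a, b[%classic = (b - a)%:E.
Proof.
move=> ab; rewrite /Defs.leb1 lebesgue_measure_itv /= lte_fin.
by case: ltgtP ab => //= ->; rewrite subrr.
Qed.

Lemma leb1_itv_oo (a b : R) : a <= b -> leb1 `]a, b[%classic = (b - a)%:E.
Proof.
move=> ab; rewrite /Defs.leb1 lebesgue_measure_itv /= lte_fin.
by case: ltgtP ab => //= ->; rewrite subrr.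
Qed.

Lemma leb1_itv_cc (a b : R) : a <= b -> leb1 `[a, b]%classic = (b - a)%:E.
Proof.
move=> ab; rewrite /Defs.leb1 lebesgue_measure_itv /= lte_fin.
by case: ltgtP ab => //= ->; rewrite subrr.
Qed.

Lemma leb1_set0 : leb1 set0 = 0%E.
Proof. exact: measure0. Qed.

Lemma integral_leb1_cst (w d : R) : 0 <= w ->
  (\int[leb1]_(x in `[(- w)%R, w]) d%:E = (2 * w * d)%:E)%E.
Proof.
move=> w0; rewrite integral_cst //.
transitivity (d%:E * leb1 `[(- w)%R, w]%classic)%E => //.
by rewrite leb1_itv_cc -?EFinM; [congr (_%:E); ring|lra].
Qed.

Lemma leb1_mono (A B : set R) : measurable A -> measurable B -> A `<=` B ->
  (leb1 A <= leb1 B)%E.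
Proof. by move=> mA mB AB; rewrite /Defs.leb1 le_measure ?inE. Qed.

Lemma sqr_lt_itv (q x : R) : 0 <= q -> (x ^+ 2 < q ^+ 2) = (- q < x < q).
Proof. by move=> q0; rewrite -(real_normK (num_real x)) ltr_pXn2r ?nnegrE // -ltr_norml. Qed.

(** Height at which the circle of radius [r] about the origin meets the vertical line of abscissa
    [x], and also half the chord cut from that line by a disk of radius [r]; it is 0 when the line
    misses the circle. *)
Definition rad (r x : R) := Num.sqrt (r ^+ 2 - x ^+ 2).

Lemma rad_ge0 r x : 0 <= rad r x. Proof. exact: sqrtr_ge0. Qed.

Lemma sqr_rad r x : x ^+ 2 <= r ^+ 2 -> rad r x ^+ 2 = r ^+ 2 - x ^+ 2.
Proof. by move=> h; rewrite sqr_sqrtr // subr_ge0. Qed.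

Lemma rad_le r1 r2 x : 0 <= r1 <= r2 -> rad r1 x <= rad r2 x.
Proof.
move=> /andP[r0 r12]; apply: ler_wsqrtr; rewrite lerD2r.
by rewrite lerXn2r ?nnegrE //; lra.
Qed.

(** The squares of the heights and the squares of the radii have the same difference, and heights
    are at most radii, so the difference of the heights has the smaller cofactor. *)
Lemma rad_sub_ge r1 r2 x : 0 <= r1 <= r2 -> x ^+ 2 <= r1 ^+ 2 ->
  r2 - r1 <= rad r2 x - rad r1 x.
Proof.
move=> /andP[r0 r12] x1.
have r122 : r1 ^+ 2 <= r2 ^+ 2 by rewrite lerXn2r ?nnegrE //; lra.
have := sqr_rad x1; have := @sqr_rad r2 x (le_trans x1 r122).
have := rad_ge0 r1 x; have := rad_ge0 r2 x.
have := @rad_le r1 r2 x; rewrite r0 r12 => /(_ isT).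
set a := rad r1 x; set b := rad r2 x => ab b0 a0 b2 a2.
have b_le : b <= r2 by rewrite -(@ler_pXn2r _ 2) // ?nnegrE //; [nra|lra].
have a_le : a <= r1 by rewrite -(@ler_pXn2r _ 2) // ?nnegrE //; nra.
rewrite leNgt; apply/negP => lt.
have : (b - a) * (b + a) = (r2 - r1) * (r2 + r1) by nra.
have [s0|s0] := eqVneq (r2 + r1) 0; first lra.
have sp : 0 < r2 + r1 by rewrite lt_def s0; lra.
nra.
Qed.

(** For [3 |x| <= r] the height is at least [10/11 * r]; the difference of squares then bounds the
    increment from above. This is where the factor 11/10 of the slope estimates comes from, and why
    radii start at [3 * q]. *)
Lemma rad_sub_le r1 r2 x : 0 < r1 <= r2 -> 9 * x ^+ 2 <= r1 ^+ 2 ->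
  rad r2 x - rad r1 x <= 11 / 10 * (r2 - r1).
Proof.
move=> /andP[r0 r12] x1.
have r122 : r1 ^+ 2 <= r2 ^+ 2 by rewrite lerXn2r ?nnegrE //; lra.
have x0 := sqr_ge0 x.
have := @sqr_rad r1 x; have := @sqr_rad r2 x.
have h1 : x ^+ 2 <= r1 ^+ 2 by lra.
have h2 : x ^+ 2 <= r2 ^+ 2 by lra.
move=> /(_ h2) b2 /(_ h1) a2; move: a2 b2.
have := rad_ge0 r1 x; have := rad_ge0 r2 x.
set a := rad r1 x; set b := rad r2 x => b0 a0 a2 b2.
have a_ge : 10 / 11 * r1 <= a by rewrite -(@ler_pXn2r _ 2) // ?nnegrE //; nra.
have b_ge : 10 / 11 * r2 <= b by rewrite -(@ler_pXn2r _ 2) // ?nnegrE //; nra.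
rewrite leNgt; apply/negP => lt.
have : (b - a) * (b + a) = (r2 - r1) * (r2 + r1) by nra.
nra.
Qed.

(** For [q <= t] the disk lies in the upper half plane, so its slices see only the upper arcs of the
    annulus. *)
Lemma xsection_piece (q t r1 r2 x : R) : 0 < q -> q <= t -> q <= r1 <= r2 ->
  x ^+ 2 < q ^+ 2 ->
  xsection (piece q (0%R, t) r1 r2) x =
  `[rad r1 x, rad r2 x[%classic `&` `](t - rad q x), (t + rad q x)[%classic.
Proof.
move=> q0 qt /andP[r1q r12] xq.
have c0 := rad_ge0 q x; have c2 := sqr_rad (ltW xq).
have q1 : q ^+ 2 <= r1 ^+ 2 by rewrite lerXn2r ?nnegrE //; lra.
have q2 : r1 ^+ 2 <= r2 ^+ 2 by rewrite lerXn2r ?nnegrE //; lra.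
have x2 := sqr_ge0 x.
have s1 : rad r1 x ^+ 2 = r1 ^+ 2 - x ^+ 2 by apply: sqr_rad; lra.
have s2 : rad r2 x ^+ 2 = r2 ^+ 2 - x ^+ 2 by apply: sqr_rad; lra.
have s10 := rad_ge0 r1 x; have s20 := rad_ge0 r2 x.
have cq : rad q x <= q by rewrite -(@ler_pXn2r _ 2) // ?nnegrE //; lra.
set c := rad q x in c0 c2 cq *; set u := rad r1 x in s1 s10 *; set v := rad r2 x in s2 s20 *.
have E (p : R) : ((p - t) ^+ 2 < c ^+ 2) = (t - c < p < t + c).
  by rewrite sqr_lt_itv //; apply/idP/idP => /andP[? ?]; apply/andP; split; lra.
apply/seteqP; split => p.
  move=> /xsectionP [] /=; rewrite subr0 => h1 /andP[h2 h3].
  have hp : (p - t) ^+ 2 < c ^+ 2 by lra.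
  rewrite E in hp; have /andP[hp1 hp2] := hp.
  have p0 : 0 <= p by lra.
  split; rewrite /= in_itv/= ?hp //.
  rewrite -(@ler_pXn2r _ 2 _ u) // ?nnegrE // -(@ltr_pXn2r _ 2 _ p) // ?nnegrE //.
  by apply/andP; split; lra.
rewrite /= !in_itv/= => -[/andP[h1 h2] h3].
have p0 : 0 <= p by lra.
apply/xsectionP; rewrite /piece /= subr0; rewrite -E in h3; split; first lra.
have g1 : u ^+ 2 <= p ^+ 2 by rewrite lerXn2r // nnegrE.
have g2 : p ^+ 2 < v ^+ 2 by rewrite ltrXn2r // nnegrE.
by apply/andP; split; lra.
Qed.

Lemma xsection_piece0 (q t r1 r2 x : R) : q ^+ 2 <= x ^+ 2 ->
  xsection (piece q (0%R, t) r1 r2) x = set0.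
Proof.
move=> h; rewrite -subset0 => p /xsectionP [] /=; rewrite subr0.
by have := sqr_ge0 (p - t); lra.
Qed.

Lemma leb2_ge_slices (A : set (R * R)) (w d : R) : measurable A -> 0 <= w -> 0 <= d ->
  (forall x, - w <= x <= w -> (d%:E <= leb1 (xsection A x))%E) ->
  ((2 * w * d)%:E <= leb2 A)%E.
Proof.
move=> mA w0 d0 h; rewrite /Defs.leb2 /product_measure1.
apply: (@le_trans _ _ (\int[leb1]_(x in `[(- w)%R, w]) d%:E)%E).
  by rewrite integral_leb1_cst.
apply: (@le_trans _ _ (\int[leb1]_(x in `[(- w)%R, w]) (leb1 \o xsection A) x)%E).
  by apply: ge0_le_integral => //; apply: measurable_funTS; exact: measurable_fun_xsection.
apply: ge0_subset_integral => //; exact: measurable_fun_xsection.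
Qed.

Lemma leb2_le_slices (A : set (R * R)) (w d : R) : measurable A -> 0 <= w -> 0 <= d ->
  (forall x, - w <= x <= w -> (leb1 (xsection A x) <= d%:E)%E) ->
  (forall x, ~ (- w <= x <= w) -> xsection A x = set0) ->
  (leb2 A <= (2 * w * d)%:E)%E.
Proof.
move=> mA w0 d0 h h0; rewrite /Defs.leb2 /product_measure1.
rewrite (_ : \int[_]_x _ = \int[leb1]_(x in `[(- w)%R, w]) (leb1 \o xsection A) x)%E; last first.
  rewrite [RHS]integral_mkcond; apply: eq_integral => x _.
  rewrite patchE; case: ifPn => // /negP; rewrite inE /= in_itv/= => /h0 /= ->.
  exact: leb1_set0.
apply: (@le_trans _ _ (\int[leb1]_(x in `[(- w)%R, w]) d%:E)%E).
  by apply: ge0_le_integral => //; apply: measurable_funTS; exact: measurable_fun_xsection.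
by rewrite integral_leb1_cst.
Qed.

Lemma leb2_piece_le (q t r1 r2 : R) : 0 < q -> q <= t -> 3 * q <= r1 <= r2 ->
  (leb2 (piece q (0%R, t) r1 r2) <= (2 * q * (11 / 10 * (r2 - r1)))%:E)%E.
Proof.
move=> q0 qt /andP[r1q r12].
apply: leb2_le_slices; [exact: measurable_piece|lra|lra| |].
  move=> x _; have [h|h] := leP (q ^+ 2) (x ^+ 2).
    by rewrite xsection_piece0 // leb1_set0 lee_fin; lra.
  rewrite xsection_piece //; last lra.
  have m1 := @measurable_itv R `[rad r1 x, rad r2 x[.
  apply: (@le_trans _ _ (leb1 `[rad r1 x, rad r2 x[%classic)).
    by apply: leb1_mono => //; exact: measurableI.
  rewrite leb1_itv_co; last by apply: rad_le; lra.
  rewrite lee_fin; apply: rad_sub_le; first lra.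
  have : (3 * q) ^+ 2 <= r1 ^+ 2 by rewrite lerXn2r ?nnegrE //; lra.
  by lra.
move=> x h; apply: xsection_piece0; rewrite leNgt sqr_lt_itv; last lra.
by apply/negP => ?; apply: h; lra.
Qed.

(* Slices whose center line meets the annulus cross it from side to side. *)
Lemma leb2_piece_ge (q t a b r1 r2 : R) : 0 < q -> 2 * q <= t ->
  3 * q <= a -> b = a + q / 2 -> a <= r1 <= r2 -> r2 <= b ->
  a ^+ 2 <= t ^+ 2 + q ^+ 2 <= b ^+ 2 ->
  ((q * (r2 - r1))%:E <= leb2 (piece q (0%R, t) r1 r2))%E.
Proof.
move=> q0 qt a3 bE /andP[ar1 r12] r2b /andP[tl tu].
have -> : q * (r2 - r1) = 2 * (q / 2) * (r2 - r1) by field.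
apply: leb2_ge_slices; [exact: measurable_piece|lra|lra|].
move=> x xw.
have x0 := sqr_ge0 x.
have x4 : x ^+ 2 <= (q / 2) ^+ 2.
  by rewrite -(real_normK (num_real x)) lerXn2r ?nnegrE // ?ler_norml; lra.
have xq : x ^+ 2 < q ^+ 2 by nra.
rewrite xsection_piece //; [|lra|lra].
have c0 := rad_ge0 q x; have c2 := sqr_rad (ltW xq).
have cge : 6 / 7 * q <= rad q x by rewrite -(@ler_pXn2r _ 2) // ?nnegrE //; nra.
set c := rad q x in c0 c2 cge *.
have t_ge : 10 / 11 * a <= t by rewrite -(@ler_pXn2r _ 2) // ?nnegrE //; nra.
(* The ends of the chord are at height [t - c] and [t + c], with squares [t^2 + q^2 - x^2] minus or
   plus [2 * t * c]. As [t^2 + q^2] lies between [a^2] and [b^2], this inequality keeps the arcs of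
   all radii in [[a, b]] between the two ends. *)
have tc : b ^+ 2 - a ^+ 2 <= 2 * t * c.
  have h1 : b ^+ 2 - a ^+ 2 = q / 2 * (2 * a + q / 2) by rewrite bE; ring.
  rewrite h1; nra.
have a0 : 0 <= a by clear -a3 q0; lra.
have r10 := le_trans a0 ar1; have r20 := le_trans r10 r12.
have r1a : a ^+ 2 <= r1 ^+ 2 by rewrite lerXn2r // nnegrE.
have r2b2 : r2 ^+ 2 <= b ^+ 2 by rewrite lerXn2r // nnegrE (le_trans r20).
have q1 : r1 ^+ 2 <= r2 ^+ 2 by rewrite lerXn2r // nnegrE.
have qa : q ^+ 2 <= a ^+ 2 by rewrite lerXn2r ?nnegrE //; clear -a3 q0; lra.
have s1 : rad r1 x ^+ 2 = r1 ^+ 2 - x ^+ 2 by apply: sqr_rad; lra.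
have s2 : rad r2 x ^+ 2 = r2 ^+ 2 - x ^+ 2 by apply: sqr_rad; lra.
have lo : t - c <= rad r1 x.
  by rewrite leNgt; apply/negP => lt; have := rad_ge0 r1 x; nra.
have hi : rad r2 x <= t + c.
  by rewrite leNgt; apply/negP => lt; have := rad_ge0 r2 x; nra.
have d : r2 - r1 <= rad r2 x - rad r1 x by apply: rad_sub_ge; [rewrite r10|clear -xq qa r1a; lra].
apply: (@le_trans _ _ (leb1 `]rad r1 x, rad r2 x[%classic)).
  by rewrite leb1_itv_oo ?lee_fin //; clear -d r12; lra.
apply: leb1_mono => //; first exact: measurableI.
by move=> z /=; rewrite !in_itv/= => /andP[z1 z2]; split; apply/andP; split; clear -z1 z2 lo hi; lra.
Qed.

(** The worst case is a circle of radius [r] that barely touches the disk. For [|x| <= q / 8] both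
    the half chord and the outer arc lose at most [q / 100] to curvature, out of the [3/40 * q]
    gained by widening the annulus; an overlap of at least [q / 20] remains in each slice. *)
Lemma leb2_piece_grow (q t r : R) : 0 < q -> 2 * q <= t -> t - q < r < t + q ->
  3 * q <= r - 3 / 40 * q ->
  ((q ^+ 2 / 80)%:E <= leb2 (piece q (0%R, t) (r - 3 / 40 * q) (r + 3 / 40 * q)))%E.
Proof.
move=> q0 qt /andP[tr rt] r3.
have -> : q ^+ 2 / 80 = 2 * (q / 8) * (q / 20) by field.
apply: leb2_ge_slices; [exact: measurable_piece|lra|lra|].
move=> x xw.
have x0 := sqr_ge0 x.
have x4 : x ^+ 2 <= (q / 8) ^+ 2.
  by rewrite -(real_normK (num_real x)) lerXn2r ?nnegrE // ?ler_norml; lra.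
have xq : x ^+ 2 < q ^+ 2 by nra.
rewrite xsection_piece //; [|lra|lra].
have c0 := rad_ge0 q x; have c2 := sqr_rad (ltW xq).
have cge : 99 / 100 * q <= rad q x by rewrite -(@ler_pXn2r _ 2) // ?nnegrE //; nra.
set c := rad q x in c0 c2 cge *.
set r1 := r - _; set r2 := r + _.
have r1E : r1 = r - 3 / 40 * q by [].
have r2E : r2 = r + 3 / 40 * q by [].
have qr1 : q <= r1 by clear -q0 r3 r1E; lra.
have r12 : r1 <= r2 by clear -q0 r1E r2E; lra.
have r10 := le_trans (ltW q0) qr1; have r20 := le_trans r10 r12.
have q1 : q ^+ 2 <= r1 ^+ 2 by rewrite lerXn2r // nnegrE // ltW.
have q2 : r1 ^+ 2 <= r2 ^+ 2 by rewrite lerXn2r // nnegrE.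
have s1 : rad r1 x ^+ 2 = r1 ^+ 2 - x ^+ 2 by apply: sqr_rad; lra.
have s2 : rad r2 x ^+ 2 = r2 ^+ 2 - x ^+ 2 by apply: sqr_rad; lra.
have s10 := rad_ge0 r1 x; have s20 := rad_ge0 r2 x.
have d : r2 - r1 <= rad r2 x - rad r1 x by apply: rad_sub_ge; [rewrite r10|clear -xq q1; lra].
have v_ge : r2 - q / 100 <= rad r2 x by rewrite -(@ler_pXn2r _ 2) // ?nnegrE //; [nra|lra].
have u_le : rad r1 x <= r1 by rewrite -(@ler_pXn2r _ 2) // ?nnegrE // s1; clear -x0; lra.
pose l := Num.max (rad r1 x) (t - c); pose u := Num.min (rad r2 x) (t + c).
have lu : q / 20 <= u - l.
  rewrite lerBrDr /u /l le_min -!lerBrDl !ge_max.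
  by do ! (apply/andP; split); clear -q0 qt tr rt v_ge u_le r1E r2E d cge; lra.
apply: (@le_trans _ _ (leb1 `]l, u[%classic)).
  by rewrite leb1_itv_oo ?lee_fin //; clear -lu q0; lra.
apply: leb1_mono => //; first exact: measurableI.
move=> z /=; rewrite !in_itv/= /l /u gt_max lt_min => /andP[/andP[z1 z2] /andP[z3 z4]].
by split; apply/andP; split => //; exact: ltW.
Qed.

Lemma leb1_slice_le (q t r1 r2 x : R) : 0 < q -> q <= t -> 3 * q <= r1 <= r2 ->
  x ^+ 2 < q ^+ 2 ->
  (leb1 (xsection (piece q (0%R, t) r1 r2) x) <= (11 / 10 * (r2 - r1))%:E)%E.
Proof.
move=> q0 qt /andP[r1q r12] xq.
rewrite xsection_piece //; last lra.
have m1 := @measurable_itv R `[rad r1 x, rad r2 x[.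
apply: (@le_trans _ _ (leb1 `[rad r1 x, rad r2 x[%classic)).
  by apply: leb1_mono => //; exact: measurableI.
rewrite leb1_itv_co; last by apply: rad_le; lra.
rewrite lee_fin; apply: rad_sub_le; first lra.
have : (3 * q) ^+ 2 <= r1 ^+ 2 by rewrite lerXn2r ?nnegrE //; lra.
by lra.
Qed.

Lemma leb1_slice_ge (q t r1 r2 x : R) : 0 < q -> q <= t -> q <= r1 <= r2 ->
  x ^+ 2 < q ^+ 2 -> t - rad q x <= rad r1 x -> rad r2 x <= t + rad q x ->
  ((r2 - r1)%:E <= leb1 (xsection (piece q (0%R, t) r1 r2) x))%E.
Proof.
move=> q0 qt /andP[r1q r12] xq lo hi.
rewrite xsection_piece //; last lra.
have d : r2 - r1 <= rad r2 x - rad r1 x.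
  apply: rad_sub_ge; first lra.
  have : q ^+ 2 <= r1 ^+ 2 by rewrite lerXn2r ?nnegrE //; lra.
  by lra.
apply: (@le_trans _ _ (leb1 `]rad r1 x, rad r2 x[%classic)).
  by rewrite leb1_itv_oo ?lee_fin //; lra.
apply: leb1_mono => //; first exact: measurableI.
by move=> z /=; rewrite !in_itv/= => /andP[z1 z2]; split; apply/andP; split; lra.
Qed.

Lemma leb2_le_slicewise (A B : set (R * R)) (k1 k2 : R) :
  measurable A -> measurable B -> 0 <= k1 -> 0 <= k2 ->
  (forall x, k1%:E * leb1 (xsection A x) <= k2%:E * leb1 (xsection B x))%E ->
  (k1%:E * leb2 A <= k2%:E * leb2 B)%E.
Proof.
move=> mA mB k10 k20 h; rewrite /Defs.leb2 /product_measure1.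
have mxA := measurable_fun_xsection (@lebesgue_measure R) mA.
have mxB := measurable_fun_xsection (@lebesgue_measure R) mB.
rewrite -!ge0_integralZl_EFin //.
apply: ge0_le_integral => //; try exact: measurable_funeM.
- by move=> x _; apply: mule_ge0.
- by move=> x _; exact: h.
Qed.

(* Below the radius [sqrt (t^2 + q^2)] no slice has left the disk, above it every slice has entered. *)
Lemma leb2_piece_rising (q t x1 x2 y1 y2 : R) : 0 < q -> q <= t ->
  3 * q <= x1 <= x2 -> x2 <= y1 <= y2 -> y2 ^+ 2 <= t ^+ 2 + q ^+ 2 ->
  ((y2 - y1)%:E * leb2 (piece q (0%R, t) x1 x2) <=
   (11 / 10 * (x2 - x1))%:E * leb2 (piece q (0%R, t) y1 y2))%E.
Proof.
move=> q0 qt /andP[h1 h2] /andP[h3 h4] hy.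
apply: leb2_le_slicewise; [exact: measurable_piece|exact: measurable_piece|lra|lra|].
move=> x; have [h|h] := leP (q ^+ 2) (x ^+ 2).
  by rewrite xsection_piece0 // leb1_set0 mule0 mule_ge0 // lee_fin; lra.
have [E|/set0P[p]] := eqVneq (xsection (piece q (0%R, t) x1 x2) x) set0.
  by rewrite E leb1_set0 mule0 mule_ge0 // lee_fin; lra.
rewrite xsection_piece //; [|lra] => -[]; rewrite /= !in_itv/= => /andP[p1 p2] /andP[p3 p4].
rewrite -xsection_piece //; last lra.
have c0 := rad_ge0 q x; have c2 := sqr_rad (ltW h).
have u1 := @leb1_slice_le q t x1 x2 x q0 qt.
have u2 := @leb1_slice_ge q t y1 y2 x q0 qt.
apply: (@le_trans _ _ ((y2 - y1)%:E * (11 / 10 * (x2 - x1))%:E)%E).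
  by apply: lee_pmul => //; [rewrite lee_fin; lra|apply: u1 => //; lra].
rewrite muleC; apply: lee_pmul => //; [rewrite lee_fin; lra|rewrite lee_fin; lra|].
apply: u2 => //; first lra.
  have : rad x2 x <= rad y1 x by apply: rad_le; lra.
  by lra.
have y20 := rad_ge0 y2 x.
have s2 : rad y2 x ^+ 2 = y2 ^+ 2 - x ^+ 2.
  apply: sqr_rad; have : q ^+ 2 <= y2 ^+ 2 by rewrite lerXn2r ?nnegrE //; lra.
  by lra.
by rewrite leNgt; apply/negP => lt; nra.
Qed.

(** The mirror case: beyond [sqrt (t^2 + q^2)] every slice has entered the disk, so a slice still
    met by the outer annulus crosses the inner one completely. *)
Lemma leb2_piece_falling (q t x1 x2 y1 y2 : R) : 0 < q -> q <= t ->
  3 * q <= x1 <= x2 -> x2 <= y1 <= y2 -> t ^+ 2 + q ^+ 2 <= x1 ^+ 2 ->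
  ((x2 - x1)%:E * leb2 (piece q (0%R, t) y1 y2) <=
   (11 / 10 * (y2 - y1))%:E * leb2 (piece q (0%R, t) x1 x2))%E.
Proof.
move=> q0 qt /andP[h1 h2] /andP[h3 h4] hy.
apply: leb2_le_slicewise; [exact: measurable_piece|exact: measurable_piece|lra|lra|].
move=> x; have [h|h] := leP (q ^+ 2) (x ^+ 2).
  by rewrite xsection_piece0 // leb1_set0 mule0 mule_ge0 // lee_fin; lra.
have [E|/set0P[p]] := eqVneq (xsection (piece q (0%R, t) y1 y2) x) set0.
  by rewrite E leb1_set0 mule0 mule_ge0 // lee_fin; lra.
rewrite xsection_piece //; [|lra] => -[]; rewrite /= !in_itv/= => /andP[p1 p2] /andP[p3 p4].
rewrite -xsection_piece //; last lra.
have c0 := rad_ge0 q x; have c2 := sqr_rad (ltW h).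
have u1 := @leb1_slice_le q t y1 y2 x q0 qt.
have u2 := @leb1_slice_ge q t x1 x2 x q0 qt.
apply: (@le_trans _ _ ((x2 - x1)%:E * (11 / 10 * (y2 - y1))%:E)%E).
  by apply: lee_pmul => //; [rewrite lee_fin; lra|apply: u1 => //; lra].
rewrite muleC; apply: lee_pmul => //; [rewrite lee_fin; lra|rewrite lee_fin; lra|].
apply: u2 => //; first lra.
  have y20 := rad_ge0 x1 x.
  have s2 : rad x1 x ^+ 2 = x1 ^+ 2 - x ^+ 2.
    apply: sqr_rad; have : q ^+ 2 <= x1 ^+ 2 by rewrite lerXn2r ?nnegrE //; lra.
    by lra.
  have cq : rad q x <= t.
    apply: le_trans qt; rewrite -(@ler_pXn2r _ 2) // ?nnegrE //; last lra.
    by rewrite c2; have := sqr_ge0 x; lra.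
  by rewrite leNgt; apply/negP => lt; nra.
have : rad x2 x <= rad y1 x by apply: rad_le; lra.
by lra.
Qed.

End Slices.

(** * The area of a disk *)

Section DiskArea.
Variable R : realType.
Local Notation leb1 := (@leb1 R).
Local Notation leb2 := (@leb2 R).
Local Notation mu := (@lebesgue_measure R).

(** The substitution that turns the integral of the chord lengths into that of [2 * q^2 * cos^2]
    over a half period. *)
Let wave (q y x : R) : R := y + q * sin x.

Let is_derive_wave (q y x : R) : is_derive x (1 : R) (wave q y) (q * cos x).
Proof.
rewrite /wave; apply: is_derive_eq.
by rewrite /GRing.scale /= add0r mul1r.
Qed.

Let derive1_wave (q y : R) : derive1 (wave q y) = (fun x => q * cos x).
Proof. by apply/funext => x; rewrite derive1E; have [_ ->] := is_derive_wave q y x. Qed.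

Let continuous_wave (q y : R) : continuous (wave q y).
Proof.
move=> x; apply: differentiable_continuous; apply/derivable1_diffP.
by have [] := is_derive_wave q y x.
Qed.

Lemma integral_sqr_cos (q : R) :
  (\int[mu]_(x in `[(- (pi / 2))%R, (pi / 2)%R]) (2 * q ^+ 2 * cos x ^+ 2)%:E = (pi * q ^+ 2)%:E)%E.
Proof.
pose F (x : R) : R := q ^+ 2 * (x + sin x * cos x).
have dF (x : R) : is_derive x (1 : R) F (2 * q ^+ 2 * cos x ^+ 2).
  rewrite /F; apply: is_derive_eq.
  rewrite /GRing.scale /=; have := cos2Dsin2 x; set c := cos x; set s := sin x => h.
  have -> : s * (- s) = - (1 - c ^+ 2) by rewrite -h; ring.
  ring.
have cF (x : R) : {for x, continuous F}.
  by apply: differentiable_continuous; apply/derivable1_diffP; have [] := dF x.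
have cf : continuous (fun x : R => 2 * q ^+ 2 * cos x ^+ 2).
  by move=> x; apply: differentiable_continuous; apply/derivable1_diffP; apply: ex_derive.
rewrite (@continuous_FTC2 R _ F); first last.
- by move=> x _; rewrite derive1E; have [_ ->] := dF x.
- split; first by move=> x _; have [] := dF x.
    exact/cvg_at_right_filter/cF.
  exact/cvg_at_left_filter/cF.
- exact: continuous_subspaceT.
- by have := @pi_gt0 R; lra.
by rewrite /F cosN cos_pihalf !mulr0 !addr0 -EFinB; congr (_%:E); field.
Qed.

Lemma integral_half_disk (q y : R) : 0 < q ->
  (\int[mu]_(x in `[(y - q)%R, (y + q)%R]) (2 * Num.sqrt (q ^+ 2 - (x - y) ^+ 2))%:E
    = (pi * q ^+ 2)%:E)%E.
Proof.
move=> q0; pose G (x : R) : R := 2 * Num.sqrt (q ^+ 2 - (x - y) ^+ 2).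
have cG : continuous G.
  move=> x; apply: (@continuousM _ _ (fun=> 2) (fun x => Num.sqrt (q ^+ 2 - (x - y) ^+ 2))); first exact: cst_continuous.
  apply: (@continuous_comp _ _ _ (fun x : R => q ^+ 2 - (x - y) ^+ 2) (@Num.sqrt R)); last exact: sqrt_continuous.
  by apply: differentiable_continuous; apply/derivable1_diffP; apply: ex_derive.
have cq (x : R) : {for x, continuous (fun x : R => q * cos x)}.
  by apply: continuousM; [exact: cst_continuous|exact: continuous_cos].
have wa : wave q y (- (pi / 2)) = y - q by rewrite /wave sinN sin_pihalf mulrN mulr1.
have wb : wave q y (pi / 2) = y + q by rewrite /wave sin_pihalf mulr1.
have pi0 := @pi_gt0 R.
have := @integration_by_substitution_increasing R (wave q y) G (- (pi / 2)) (pi / 2).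
rewrite wa wb derive1_wave => ->; first last.
- exact: continuous_subspaceT.
- split; first by move=> x _; have [] := is_derive_wave q y x.
    exact/cvg_at_right_filter/continuous_wave.
  exact/cvg_at_left_filter/continuous_wave.
- by apply/cvg_ex; exists (q * cos (pi / 2)); exact/cvg_at_left_filter/cq.
- by apply/cvg_ex; exists (q * cos (- (pi / 2))); exact/cvg_at_right_filter/cq.
- by move=> x _; exact: cq.
- move=> a b ha hb ab; rewrite /wave ltrD2l ltr_pM2l //.
  by rewrite ltr_sin.
- lra.
rewrite -integral_sqr_cos; apply: eq_integral => x; rewrite inE /= in_itv/= => /andP[xa xb].
congr (_%:E); rewrite /wave /G /=.
have c0 : 0 <= cos x by apply: cos_ge0_pihalf; rewrite xa.
transitivity (2 * Num.sqrt (q ^+ 2 - (y + q * sin x - y) ^+ 2) * (q * cos x)) => //.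
have -> : q ^+ 2 - (y + q * sin x - y) ^+ 2 = (q * cos x) ^+ 2.
  have := cos2Dsin2 x; set c := cos x; set s := sin x => h.
  by rewrite -[q ^+ 2]mulr1 -h; ring.
rewrite sqrtr_sqr ger0_norm; last by rewrite mulr_ge0 // ltW.
ring.
Qed.

Lemma leb2_disk (y : R * R) (q : R) : 0 < q -> leb2 (disk y q) = (pi * q ^+ 2)%:E.
Proof.
move=> q0; rewrite -(integral_half_disk y.1 q0) /Defs.leb2 /product_measure1.
rewrite [RHS]integral_mkcond; apply: eq_integral => x _.
rewrite patchE; case: ifPn => [|/negP]; rewrite inE /= in_itv/= => hx.
  have h0 : 0 <= q ^+ 2 - (x - y.1) ^+ 2.
    by rewrite subr_ge0 -(real_normK (num_real (x - y.1))) lerXn2r ?nnegrE // ?ler_norml; lra.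
  have s2 := sqr_sqrtr h0; have s0 := sqrtr_ge0 (q ^+ 2 - (x - y.1) ^+ 2).
  set s := Num.sqrt _ in s2 s0 *.
  rewrite (_ : xsection _ _ = `](y.2 - s), (y.2 + s)[%classic).
    rewrite /Defs.leb1 lebesgue_measure_itv /= lte_fin; case: ifPn => h; last by congr (_%:E); lra.
    by rewrite -EFinB; congr (_%:E); ring.
  apply/seteqP; split => p.
    move=> /xsectionP [] /= h _; rewrite in_itv/=.
    have : (p - y.2) ^+ 2 < s ^+ 2 by lra.
    rewrite -(real_normK (num_real (p - y.2))) ltr_pXn2r ?nnegrE // ltr_norml => /andP[? ?].
    by apply/andP; split; lra.
  rewrite /= in_itv/= => /andP[p1 p2]; apply/xsectionP; split => //=.
  have : (p - y.2) ^+ 2 < s ^+ 2.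
    by rewrite -(real_normK (num_real (p - y.2))) ltr_pXn2r ?nnegrE // ltr_norml; apply/andP; split; lra.
  by lra.
rewrite (_ : xsection _ _ = set0); first exact: measure0.
rewrite -subset0 => p /xsectionP [] /= h _; apply: hx.
have : (x - y.1) ^+ 2 < q ^+ 2 by have := sqr_ge0 (p - y.2); lra.
rewrite -(real_normK (num_real (x - y.1))) ltr_pXn2r ?nnegrE // ?ltr_norml; last lra.
by move=> /andP[? ?]; apply/andP; split; lra.
Qed.

End DiskArea.

(** * Growth of the covered fraction of a single disk *)

Section Caps.
Variable R : realType.
Local Notation leb2 := (@leb2 R).

(* Average slopes of [f] over successive intervals of [[a, b]] decrease by at most a factor [C]. *)
Definition slope_up (C a b : R) (f : R -> R) := forall x1 x2 y1 y2,
  a <= x1 <= x2 -> x2 <= y1 <= y2 -> y2 <= b ->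
  (y2 - y1) * (f x2 - f x1) <= C * (x2 - x1) * (f y2 - f y1).

(** The mirror condition, in which slopes increase by at most a factor [C]. Cross-multiplication
    avoids derivatives and makes degenerate intervals harmless. *)
Definition slope_down (C a b : R) (f : R -> R) := forall x1 x2 y1 y2,
  a <= x1 <= x2 -> x2 <= y1 <= y2 -> y2 <= b ->
  (x2 - x1) * (f y2 - f y1) <= C * (y2 - y1) * (f x2 - f x1).

Variables (q : R) (y : R * R).
Hypothesis q_gt0 : 0 < q.

Definition cover r := area (disk (origin R) r `&` disk y q) / (pi * q ^+ 2).

Lemma enorm_ge0 : 0 <= enorm y. Proof. exact: sqrtr_ge0. Qed.

Let pq : 0 < pi * q ^+ 2. Proof. by rewrite mulr_gt0 ?pi_gt0 // exprn_gt0. Qed.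

Let mcap r : measurable (disk (origin R) r `&` disk y q).
Proof. by apply: measurableI; exact: measurable_disk. Qed.

Lemma leb2_sub_disk (A : set (R * R)) : measurable A -> A `<=` disk y q -> leb2 A \is a fin_num.
Proof.
have q0 := q_gt0.
move=> mA Ay; rewrite ge0_fin_numE; last by rewrite /Defs.leb2.
apply: (@le_lt_trans _ _ (leb2 (disk y q))).
  by rewrite /Defs.leb2 le_measure ?inE //; exact: measurable_disk.
by rewrite leb2_disk // ltry.
Qed.

Lemma coverB (r1 r2 : R) : 0 < r1 <= r2 ->
  cover r2 - cover r1 = fine (leb2 (piece q (0, enorm y) r1 r2)) / (pi * q ^+ 2).
Proof.
have q0 := q_gt0.
move=> /andP[r0 r12]; rewrite -leb2_piece -mulrBl /area; congr (_ / _).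
have E : disk (origin R) r2 `&` disk y q =
    (disk (origin R) r1 `&` disk y q) `|` piece q y r1 r2.
  have r122 : r1 ^+ 2 <= r2 ^+ 2 by rewrite lerXn2r ?nnegrE //; lra.
  apply/seteqP; split => p; rewrite /disk /piece /= !subr0.
    move=> [[h1 h2] [h3 h4]]; have [h|h] := ltP (p.1 ^+ 2 + p.2 ^+ 2) (r1 ^+ 2).
      by left.
    by right; rewrite h1.
  move=> [[[h1 h2] [h3 h4]]|[h1 /andP[h2 h3]]]; do !split => //; lra.
have m1 := mcap r1; have m2 := @measurable_piece R q y r1 r2.
have E2 : leb2 (disk (origin R) r2 `&` disk y q) =
  (leb2 (disk (origin R) r1 `&` disk y q) + leb2 (piece q y r1 r2))%E.
  rewrite E /Defs.leb2 measureU //.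
  by rewrite -subset0 => p [[]]; rewrite /disk /piece /= !subr0 => -[h1 _] _ [_ /andP[h2 _]]; lra.
rewrite E2 fineD ?addrK //; first by rewrite addrC addKr.
  by apply: leb2_sub_disk => // p [].
apply: leb2_sub_disk => // p [] /= h _; split => //.
Qed.

Let piece_fin r1 r2 : leb2 (piece q (0, enorm y) r1 r2) \is a fin_num.
Proof.
have q0 := q_gt0.
rewrite -leb2_piece; apply: leb2_sub_disk; first exact: measurable_piece.
by move=> p [] /= h _; split.
Qed.

Lemma cover_far (r : R) : 0 < r -> r <= enorm y - q -> cover r = 0.
Proof.
have q0 := q_gt0.
move=> r0 h; rewrite /cover (_ : _ `&` _ = set0); first by rewrite /area /Defs.leb2 measure0 /= mul0r.
rewrite -subset0 => p [[]]; rewrite /= !subr0 => h1 _ [h2 _].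
have t2 := sqr_enorm y; set t := enorm y in h t2.
have h3 : p.1 ^+ 2 + p.2 ^+ 2 < (t - q) ^+ 2.
  by apply: (lt_le_trans h1); rewrite lerXn2r ?nnegrE //; lra.
have cs : (p.1 * y.1 + p.2 * y.2) ^+ 2 <= (p.1 ^+ 2 + p.2 ^+ 2) * t ^+ 2.
  by rewrite t2; have := sqr_ge0 (p.1 * y.2 - p.2 * y.1); lra.
have s2 := sqr_enorm p; have s0 : 0 <= enorm p by exact: sqrtr_ge0.
set s := enorm p in s2 s0.
have st : s < t - q by rewrite -(@ltr_pXn2r _ 2) ?nnegrE //; lra.
have : p.1 * y.1 + p.2 * y.2 <= s * t.
  have st0 : 0 <= s * t by apply: mulr_ge0 => //; lra.
  have [d0|d0] := leP (p.1 * y.1 + p.2 * y.2) 0; first lra.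
  rewrite -(@ler_pXn2r _ 2) ?nnegrE //; last exact: ltW.
  by rewrite [in leRHS]exprMn s2.
have : q ^+ 2 < (t - s) ^+ 2 by rewrite ltr_pXn2r ?nnegrE //; lra.
by lra.
Qed.

Lemma cover_near (r : R) : enorm y + q <= r -> cover r = 1.
Proof.
have q0 := q_gt0.
move=> h; rewrite /cover (_ : _ `&` _ = disk y q).
  by rewrite /area leb2_disk //= divff // gt_eqF.
apply/seteqP; split => [p []//|p hp]; split => //; move: hp.
rewrite /disk /= !subr0 => -[h1 _].
have t2 := sqr_enorm y; have t0 := enorm_ge0; set t := enorm y in h t2 t0.
split; last lra.
have h3 : (t + q) ^+ 2 <= r ^+ 2 by rewrite lerXn2r ?nnegrE //; lra.
apply: lt_le_trans h3.
set w := (p.1 - y.1) ^+ 2 + (p.2 - y.2) ^+ 2 in h1.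
set d := (p.1 - y.1) * y.1 + (p.2 - y.2) * y.2.
have E : p.1 ^+ 2 + p.2 ^+ 2 = w + 2 * d + t ^+ 2 by rewrite t2 /w /d; ring.
have w0 : 0 <= w by rewrite addr_ge0 // sqr_ge0.
have cs : d ^+ 2 <= w * t ^+ 2.
  by rewrite t2 /w /d; have := sqr_ge0 ((p.1 - y.1) * y.2 - (p.2 - y.2) * y.1); lra.
have : d <= q * t.
  have qt : 0 <= q * t by rewrite mulr_ge0 // ltW.
  have [d0|d0] := leP d 0; first lra.
  rewrite -(@ler_pXn2r _ 2) // ?nnegrE //; last exact: ltW.
  rewrite exprMn; apply: (le_trans cs); apply: ler_wpM2r; [exact: sqr_ge0|exact: ltW].
by rewrite E; lra.
Qed.

Lemma cover_lip (r1 r2 : R) : 3 * q <= r1 <= r2 ->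
  0 <= cover r2 - cover r1 <= 11 / 5 / (pi * q) * (r2 - r1).
Proof.
have q0 := q_gt0; have q_neq0 := lt0r_neq0 q0; have p_neq0 := lt0r_neq0 (@pi_gt0 R).
move=> /andP[r1q r12]; rewrite coverB; last lra.
apply/andP; split; first by apply: divr_ge0; [apply: fine_ge0; exact: measure_ge0|exact: ltW].
(* A disk with center nearer than [q] is already covered at radius [3 * q], so both fractions are
   1. *)
have [t2q|t2q] := leP q (enorm y); last first.
  rewrite -coverB ?cover_near ?subrr; try lra.
  by rewrite mulr_ge0 ?subr_ge0 // divr_ge0 // ltW // mulr_gt0 // pi_gt0.
have h := @leb2_piece_le R q (enorm y) r1 r2 q0 t2q.
rewrite -[X in (X <= _)%E]fineK // lee_fin in h.
rewrite ler_pdivrMr //.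
have -> : 11 / 5 / (pi * q) * (r2 - r1) * (pi * q ^+ 2) = 2 * q * (11 / 10 * (r2 - r1)).
  by move: p_neq0; generalize (@pi R) => P P0; field; rewrite P0 q_neq0.
by apply: h; rewrite r1q.
Qed.

Lemma cover_grow (r : R) : enorm y - q < r < enorm y + q -> 3 * q <= r - 3 / 40 * q ->
  320^-1 <= cover (r + 3 / 40 * q) - cover (r - 3 / 40 * q).
Proof.
have q0 := q_gt0.
move=> h1 h2; rewrite coverB; last lra.
rewrite ler_pdivlMr //.
have h : 2 * q <= enorm y by lra.
have := leb2_piece_grow q0 h h1 h2; rewrite -[X in (_ <= X)%E]fineK // lee_fin.
apply: le_trans.
(* The piece has area at least [q^2 / 80], and [pi < 4] turns its share of the disk into 1/320. *)
have := @pihalf_lt2 R; have := sqr_ge0 q; nra.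
Qed.

(** The three outcomes correspond to the turning radius [sqrt (t^2 + q^2)] lying beyond the cell,
    before it, or inside it; disks already covered are put with the first kind. *)
Lemma cover_cell (a b : R) : 3 * q <= a -> b = a + q / 2 ->
  [\/ slope_up (11 / 10) a b cover, slope_down (11 / 10) a b cover |
      slope_up (11 / 5) a b cover /\ slope_down (11 / 5) a b cover].
Proof.
have q0 := q_gt0; have q_neq0 := lt0r_neq0 q0; have p_neq0 := lt0r_neq0 (@pi_gt0 R).
move=> a3 bE; have [t2q|t2q] := leP (2 * q) (enorm y); last first.
  apply: Or31 => x1 x2 y1 y2 hx hy hb.
  by rewrite !cover_near ?subrr ?mulr0 //; lra.
have t1q : q <= enorm y by lra.
set t := enorm y in t2q t1q.
have fE r1 r2 : leb2 (piece q (0, t) r1 r2) = (fine (leb2 (piece q (0, t) r1 r2)))%:E.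
  by rewrite fineK //; exact: piece_fin.
have D r1 r2 : a <= r1 <= r2 -> cover r2 - cover r1 = fine (leb2 (piece q (0, t) r1 r2)) / (pi * q ^+ 2).
  by move=> hr; rewrite coverB //; lra.
have Q (k1 k2 : R) (X Y : \bar R) : X \is a fin_num -> Y \is a fin_num -> (k1%:E * X <= k2%:E * Y)%E ->
    k1 * (fine X / (pi * q ^+ 2)) <= k2 * (fine Y / (pi * q ^+ 2)).
  move=> Xf Yf; rewrite -(fineK Xf) -(fineK Yf) -!EFinM lee_fin /= => h.
  by rewrite [leLHS]mulrA [leRHS]mulrA ler_pM2r ?invr_gt0.
have ord x1 x2 y1 y2 : a <= x1 <= x2 -> x2 <= y1 <= y2 -> y2 <= b ->
    [/\ 0 <= a, a <= y1 <= y2 & 0 <= y2].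
  by clear -q0 a3 => /andP[? ?] /andP[? ?] ?; split; lra.
have [tb|tb] := leP (b ^+ 2) (t ^+ 2 + q ^+ 2).
  apply: Or31 => x1 x2 y1 y2 hx hy hb.
  have [ax ay by0] := ord x1 x2 y1 y2 hx hy hb; have /andP[a0 x12] := hx.
  rewrite (D x1 x2) // (D y1 y2) //.
  apply: Q; [exact: piece_fin|exact: piece_fin|].
  apply: leb2_piece_rising => //; first by rewrite x12 (le_trans a3).
  by apply: le_trans tb; rewrite lerXn2r // nnegrE // (le_trans by0).
have [ta|ta] := leP (t ^+ 2 + q ^+ 2) (a ^+ 2).
  apply: Or32 => x1 x2 y1 y2 hx hy hb.
  have [ax ay by0] := ord x1 x2 y1 y2 hx hy hb; have /andP[a0 x12] := hx.
  rewrite (D x1 x2) // (D y1 y2) //.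
  apply: Q; [exact: piece_fin|exact: piece_fin|].
  apply: leb2_piece_falling => //; first by rewrite x12 (le_trans a3).
  by apply: (le_trans ta); rewrite lerXn2r // nnegrE // (le_trans ax).
(* The turning radius is inside the cell. The slices with [|x| <= q / 2] alone give a lower bound on
   the rate, all slices an upper one; their ratio is [2 * (11/10)], so slopes are comparable in both
   directions. *)
have lo r1 r2 : a <= r1 <= r2 -> r2 <= b ->
    q * (r2 - r1) / (pi * q ^+ 2) <= cover r2 - cover r1.
  move=> hr hb; rewrite D // ler_pM2r ?invr_gt0 // -lee_fin -fE.
  by apply: (@leb2_piece_ge R q t a b) => //; rewrite !ltW.
have up r1 r2 : a <= r1 <= r2 ->
    cover r2 - cover r1 <= 11 / 5 * (q * (r2 - r1) / (pi * q ^+ 2)).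
  move=> hr; rewrite D // [leRHS]mulrA ler_pM2r ?invr_gt0 // -lee_fin -fE.
  apply: (@le_trans _ _ (2 * q * (11 / 10 * (r2 - r1)))%:E).
    by apply: leb2_piece_le => //; lra.
  by rewrite lee_fin; lra.
apply: Or33; split => x1 x2 y1 y2 hx hy hb.
  have h1 := up x1 x2 hx; have h2 := lo y1 y2.
  have {}h2 := h2 ltac:(clear -hx hy hb; lra) hb.
  apply: (@le_trans _ _ ((y2 - y1) * (11 / 5 * (q * (x2 - x1) / (pi * q ^+ 2))))).
    by apply: ler_wpM2l => //; clear -hx hy hb q0; lra.
  apply: (@le_trans _ _ (11 / 5 * (x2 - x1) * (q * (y2 - y1) / (pi * q ^+ 2)))).
    by set w := (pi * q ^+ 2)^-1; rewrite le_eqVlt; apply/orP; left; apply/eqP; ring.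
  by apply: ler_wpM2l => //; clear -hx hy hb q0; lra.
have h1 := up y1 y2 ltac:(clear -hx hy hb; lra); have h2 := lo x1 x2 hx ltac:(clear -hx hy hb; lra).
apply: (@le_trans _ _ ((x2 - x1) * (11 / 5 * (q * (y2 - y1) / (pi * q ^+ 2))))).
  by apply: ler_wpM2l => //; clear -hx hy hb q0; lra.
apply: (@le_trans _ _ (11 / 5 * (y2 - y1) * (q * (x2 - x1) / (pi * q ^+ 2)))).
  by set w := (pi * q ^+ 2)^-1; rewrite le_eqVlt; apply/orP; left; apply/eqP; ring.
by apply: ler_wpM2l => //; clear -hx hy hb q0; lra.
Qed.

End Caps.

(** * Slope conditions for sums *)

Section Slopes.
Variable R : realType.
Implicit Types (a b C : R) (f : R -> R).

Lemma slope_up_sum (I : finType) (P : pred I) (g : I -> R -> R) C a b :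
  (forall i, P i -> slope_up C a b (g i)) ->
  slope_up C a b (fun r => \sum_(i | P i) g i r).
Proof.
move=> h x1 x2 y1 y2 hx hy hb; rewrite -!sumrB !mulr_sumr.
by apply: ler_sum => i Pi; exact: h.
Qed.

Lemma slope_down_sum (I : finType) (P : pred I) (g : I -> R -> R) C a b :
  (forall i, P i -> slope_down C a b (g i)) ->
  slope_down C a b (fun r => \sum_(i | P i) g i r).
Proof.
move=> h x1 x2 y1 y2 hx hy hb; rewrite -!sumrB !mulr_sumr.
by apply: ler_sum => i Pi; exact: h.
Qed.

(** The gap [[z1, z2]] decides. If [p] grows there at least as much as [d], then to its right [p]
    has only gained speed and [d] only lost speed, up to factors, so [p] dominates [d] on [[z2, b]];
    otherwise [d] dominates [p] on [[a, z1]]. The dominated part is absorbed at the cost of a larger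
    constant. *)
Lemma slope_dichotomy (p d m : R -> R) a z1 z2 b : a <= z1 -> z1 < z2 -> z2 <= b ->
  {in `[a, b] &, nondecreasing_fun p} -> {in `[a, b] &, nondecreasing_fun d} ->
  {in `[a, b] &, nondecreasing_fun m} ->
  slope_up (11 / 10) a b p -> slope_down (11 / 10) a b d ->
  slope_up (11 / 5) a b m -> slope_down (11 / 5) a b m ->
  slope_up 3 z2 b (fun r => p r + d r + m r) \/
  slope_down 3 a z1 (fun r => p r + d r + m r).
Proof.
move=> az z12 zb pn dn mn pu dd mu md.
have mono f (fn : {in `[a, b] &, nondecreasing_fun f}) r s : a <= r <= s -> s <= b -> 0 <= f s - f r.
  by move=> hr hs; rewrite subr_ge0; apply: fn; rewrite ?in_itv/=; lra.
have az2 := le_trans az (ltW z12); have z1b := le_trans (ltW z12) zb.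
have hz1 : a <= z1 <= z2 by rewrite az ltW.
have [h|h] := leP (d z2 - d z1) (p z2 - p z1); [left|right] => x1 x2 y1 y2 hx hy hb;
    move: (hx) (hy) => /andP[zx x12] /andP[xy y12].
  have x2b := le_trans xy (le_trans y12 hb); have ax := le_trans az2 zx.
  have ax12 : a <= x1 <= x2 by rewrite ax.
  have ay12 : a <= y1 <= y2 by rewrite y12 andbT (le_trans ax) // (le_trans x12).
  have x0 : 0 <= x2 - x1 by rewrite subr_ge0.
  have y0 : 0 <= y2 - y1 by rewrite subr_ge0.
  have p1 := pu z1 z2 x1 x2 hz1 hx x2b.
  have d1 := dd z1 z2 x1 x2 hz1 hx x2b.
  have p2 := pu x1 x2 y1 y2 ax12 hy hb.
  have m2 := mu x1 x2 y1 y2 ax12 hy hb.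
  have px := mono _ pn x1 x2 ax12 x2b.
  have py := mulr_ge0 x0 (mono _ pn y1 y2 ay12 hb).
  have dy := mulr_ge0 x0 (mono _ dn y1 y2 ay12 hb).
  have my := mulr_ge0 x0 (mono _ mn y1 y2 ay12 hb).
  (* Two factors 11/10, one from each slope condition against the gap. The total is
     [11/10 * (1 + 121/100) < 3], and [m] contributes only 11/5. *)
  have dx : d x2 - d x1 <= 121 / 100 * (p x2 - p x1).
    rewrite -(@ler_pM2l _ (z2 - z1)) ?subr_gt0 //.
    have := ler_wpM2l x0 h; clear -p1 d1; lra.
  have := ler_wpM2l y0 dx; clear -p2 m2 py dy my; lra.
have ay : a <= y1 by case/andP: hx => ax _; apply: le_trans xy; apply: le_trans x12.
have ay12 : a <= y1 <= y2 by rewrite ay.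
have yz : y2 <= z1 <= z2 by rewrite hb ltW.
have y2b := le_trans hb z1b; have x2b := le_trans xy (le_trans y12 y2b).
have x0 : 0 <= x2 - x1 by rewrite subr_ge0.
have y0 : 0 <= y2 - y1 by rewrite subr_ge0.
have d1 := dd y1 y2 z1 z2 ay12 yz zb.
have p1 := pu y1 y2 z1 z2 ay12 yz zb.
have d2 := dd x1 x2 y1 y2 hx hy y2b.
have m2 := md x1 x2 y1 y2 hx hy y2b.
have px := mulr_ge0 y0 (mono _ pn x1 x2 hx x2b).
have dx := mulr_ge0 y0 (mono _ dn x1 x2 hx x2b).
have mx := mulr_ge0 y0 (mono _ mn x1 x2 hx x2b).
have py : p y2 - p y1 <= 121 / 100 * (d y2 - d y1).
  rewrite -(@ler_pM2l _ (z2 - z1)) ?subr_gt0 //.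
  have := ler_wpM2l y0 (ltW h); clear -p1 d1; lra.
have := ler_wpM2l x0 py; clear -d2 m2 px dx mx; lra.
Qed.

Lemma slope_sum_dichotomy (I : finType) (g : I -> R -> R) a z1 z2 b :
  a <= z1 -> z1 < z2 -> z2 <= b ->
  (forall i, {in `[a, b] &, nondecreasing_fun (g i)}) ->
  (forall i, [\/ slope_up (11 / 10) a b (g i), slope_down (11 / 10) a b (g i) |
      slope_up (11 / 5) a b (g i) /\ slope_down (11 / 5) a b (g i)]) ->
  slope_up 3 z2 b (fun r => \sum_i g i r) \/ slope_down 3 a z1 (fun r => \sum_i g i r).
Proof.
move=> az z12 zb gn gs.
pose U i := `[< slope_up (11 / 10) a b (g i) >].
pose D i := `[< slope_down (11 / 10) a b (g i) >].
have E : (fun r => \sum_i g i r) = (fun r => \sum_(i | U i) g i r +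
    \sum_(i | ~~ U i && D i) g i r + \sum_(i | ~~ U i && ~~ D i) g i r).
  by apply/funext => r; rewrite -addrA (bigID U) /=; congr (_ + _); rewrite (bigID D).
have sn (P : pred I) : {in `[a, b] &, nondecreasing_fun (fun r => \sum_(i | P i) g i r)}.
  by move=> r s hr hs rs; apply: ler_sum => i _; exact: gn.
rewrite E; apply: slope_dichotomy => //.
- by apply: slope_up_sum => i /asboolP.
- by apply: slope_down_sum => i /andP[_ /asboolP].
- by apply: slope_up_sum => i /andP[/asboolP u /asboolP d]; case: (gs i) => // -[].
- by apply: slope_down_sum => i /andP[/asboolP u /asboolP d]; case: (gs i) => // -[].
Qed.

End Slopes.

(** * Charging the radii near even integers to good radii *)

Section GoodSet.
Variable R : realType.
Local Notation mu := (@lebesgue_measure R).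

Definition far_from_even (delta : R) : set R :=
  [set v | forall k : int, delta <= `|v - 2 * k%:~R|].

Lemma closed_far_from_even delta : closed (far_from_even delta).
Proof.
rewrite (_ : far_from_even delta = \bigcap_(k in [set: int]) [set v | delta <= `|v - 2 * k%:~R|]).
  apply: closed_bigI => k _.
  rewrite (_ : [set v | _] = (fun v : R => `|v - 2 * k%:~R|) @^-1` [set x | delta <= x]) //.
  apply: closed_comp; last exact: closed_ge.
  move=> x _; apply: cvg_norm.
  by apply: cvgB; [exact: cvg_id|exact: cvg_cst].
by apply/seteqP; split => [v h k _|v h k]; exact: h.
Qed.

(** The bound 3/4 is the largest value of [3 * delta] for [delta <= 1/4]: neighborhoods of distinct
    even integers stay disjoint even when widened threefold. *)
Lemma even_separated (k l : int) (v : R) : `|v - 2 * k%:~R| <= 3 / 4 ->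
  `|v - 2 * l%:~R| <= 3 / 4 -> k = l.
Proof.
rewrite !ler_norml => /andP[h1 h2] /andP[h3 h4].
apply/eqP; rewrite -subr_eq0 -absz_eq0 -leqn0 -ltnS -ltz_nat abszE.
rewrite -(@ltr_int R) intr_norm rmorphB /= ltr_norml.
by apply/andP; split; rewrite -?[1%:~R]/(1 : R); lra.
Qed.

Variables (Psi : R -> R) (j0 j1 delta : R).
Hypothesis Psi_nd : {in `[j0, j1] &, nondecreasing_fun Psi}.
Hypothesis Psi_cont : {within `[j0, j1], continuous Psi}.
Hypothesis delta_itv : 0 < delta <= 4^-1.

Definition good_set : set R := `[j0, j1] `&` Psi @^-1` far_from_even delta.

Lemma measurable_good_set : measurable good_set.
Proof.
have m : measurable_fun `[j0, j1] Psi.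
  exact: subspace_continuous_measurable_fun.
by apply: m => //; apply: closed_measurable; exact: closed_far_from_even.
Qed.

(* Every component of the bad set in [[s0, s1]] is charged to an interval of good points near it. *)
Lemma good_set_charging (s0 s1 : R) : j0 <= s0 -> s0 <= s1 -> s1 <= j1 ->
  (forall k : int, (exists r, s0 <= r <= s1 /\ `|Psi r - 2 * k%:~R| < delta) ->
    exists x1 x2, [/\ j0 <= x1 <= x2, x2 <= j1,
      (forall r, x1 <= r <= x2 -> delta <= `|Psi r - 2 * k%:~R| <= 3 * delta) &
      (forall y1 y2, s0 <= y1 <= y2 -> y2 <= s1 -> `|Psi y1 - 2 * k%:~R| < delta ->
         `|Psi y2 - 2 * k%:~R| < delta -> y2 - y1 <= 3 * (x2 - x1))]) ->
  (((s1 - s0) / 4)%:E <= mu good_set)%E.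
Proof.
move=> js ss sj charge.
have /andP[d0 d1] := delta_itv.
pose B (k : int) : set R := [set r | s0 <= r <= s1 /\ `|Psi r - 2 * k%:~R| < delta].
(* [WX.1] is the interval hull of the radii that are bad for [k], and [WX.2] the interval of good
   radii that pays for it; both are empty if no radius is bad for [k]. *)
have X_exists (k : int) : exists WX : set R * set R,
    [/\ measurable WX.1, measurable WX.2, B k `<=` WX.1 /\ (mu WX.1 <= 3%:E * mu WX.2)%E,
      WX.2 `<=` `[j0, j1] & forall r, WX.2 r -> delta <= `|Psi r - 2 * k%:~R| <= 3 * delta].
  have [Bk|Bk] := pselect (B k !=set0); last first.
    exists (set0, set0); split => //=; split; last by rewrite measure0 mule0.
    by move=> r Br; apply: Bk; exists r.
  have [x1 [x2 [h1 h2 h3 h4]]] := charge k Bk.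
  have Bs : has_sup (B k).
    by split=> //; exists s1 => r [/andP[]].
  have Bi : has_inf (B k).
    by split=> //; exists s0 => r [/andP[]].
  have d : sup (B k) - inf (B k) <= 3 * (x2 - x1).
    rewrite lerBlDr; apply: ge_sup => // r2 r2B.
    rewrite addrC -lerBlDr; apply: lb_le_inf => // r1 r1B.
    have [/andP[a1 a2] a3] := r1B; have [/andP[b1 b2] b3] := r2B.
    have [r12|r12] := leP r1 r2; last by clear -r12 h1; lra.
    have := h4 r1 r2; rewrite a1 r12 => /(_ isT b2 a3 b3) h; lra.
  have is_le : inf (B k) <= sup (B k).
    have [r rB] := Bk; apply: (@le_trans _ _ r).
      by apply: ge_inf => //; case: Bi.
    by apply: ub_le_sup => //; case: Bs.
  exists (`[inf (B k), sup (B k)]%classic, `[x1, x2]%classic); split => //=.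
  - split.
      move=> r rB /=; rewrite in_itv/=; apply/andP; split.
        by apply: ge_inf => //; case: Bi.
      by apply: ub_le_sup => //; case: Bs.
    rewrite !lebesgue_measure_itv /= !lte_fin.
    case: ltP => [_|e1]; last first.
      by case: ltP => _; rewrite ?mule0 // -EFinB -EFinM lee_fin; lra.
    by case: ltP => e2; rewrite ?mule0 -?EFinB -?EFinM lee_fin; lra.
  - by move=> r /=; rewrite !in_itv/= => /andP[? ?]; apply/andP; split; lra.
have [WX hWX] := choice X_exists.
have Psi_bd (r : R) : j0 <= r <= j1 -> Psi j0 <= Psi r <= Psi j1.
  by move=> /andP[r0 r1]; apply/andP; split; apply: Psi_nd => //; rewrite in_itv/= ?lexx ?r0 ?r1 ?(le_trans js) ?(le_trans ss).
pose M : R := `|Psi j0| + `|Psi j1| + 1.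
pose Q := Num.bound M.
have QM : M < Q%:R by apply: archi_boundP; rewrite !addr_ge0.
(* Countable unions run over natural numbers, so the integers are shifted by a bound on [Psi]: an
   even integer [2 * k] close to a value of [Psi] has [k >= - Q]. *)
pose idx (n : nat) : int := n%:Z - Q%:Z.
pose G := good_set.
have mG : measurable G := measurable_good_set.
pose W n := (WX (idx n)).1; pose X n := (WX (idx n)).2.
have mW n : measurable (W n) by have [] := hWX (idx n).
have mX n : measurable (X n) by have [] := hWX (idx n).
have cov : `[s0, s1]%classic `<=` G `|` \bigcup_n W n.
  move=> r /=; rewrite in_itv/= => rs; have /andP[r0 r1] := rs.
  have [Gr|/existsNP[k /negP]] := pselect (far_from_even delta (Psi r)).
    by left; split => //=; rewrite in_itv/=; lra.
  rewrite -ltNge => hk; right.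
  have kQ : (0 <= k + Q%:Z)%R.
    have /andP[P0 P1] : Psi j0 <= Psi r <= Psi j1.
      by apply: Psi_bd; clear -r0 r1 js sj; lra.
    move: hk; rewrite ltr_norml => /andP[k0 k1].
    have a0 := ler_norm (- Psi j0); rewrite normrN in a0.
    have a1 := normr_ge0 (Psi j1); have a2 := normr_ge0 (Psi j0).
    rewrite -(@ler_int R) rmorphD /= -[Q%:Z%:~R]/(Q%:R : R).
    rewrite -[0%:~R]/(0 : R); move: QM; rewrite /M => QM.
    by clear -QM a0 a1 a2 k0 k1 P0 P1 d1; lra.
  exists (absz (k + Q%:Z)) => //; rewrite /W /idx gez0_abs // addrK.
  by have [_ _ [h _] _ _] := hWX k; apply: h; split.
have XG n : X n `<=` G.
  have [_ _ _ h1 h2] := hWX (idx n); move=> r Xr; split; first exact: h1.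
  move=> l; have [->|kl] := eqVneq l (idx n); first by have /andP[] := h2 r Xr.
  rewrite leNgt; apply/negP => hl; move/eqP: kl; apply.
  have /andP[_ h3] := h2 r Xr.
  by apply: (@even_separated _ _ (Psi r)); clear -h3 hl d0 d1; lra.
(* On [X n] the function stays within [3 * delta] of the even integer of index [idx n], so no good
   radius is charged twice. *)
have tX : trivIset setT X.
  apply/trivIsetP => m n _ _ mn; rewrite -subset0 => r [Xm Xn].
  have [_ _ _ _ /(_ r Xm)/andP[_ hm]] := hWX (idx m).
  have [_ _ _ _ /(_ r Xn)/andP[_ hn]] := hWX (idx n).
  have : idx m = idx n by apply: (@even_separated _ _ (Psi r)); clear -hm hn d1; lra.
  by rewrite /idx => /addIr [E]; move: mn; rewrite E eqxx.
have ms : mu `[s0, s1]%classic = (s1 - s0)%:E.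
  rewrite lebesgue_measure_itv /= lte_fin; case: ltP => //.
  by move=> h; congr (_%:E); lra.
have mUW : measurable (\bigcup_n W n) by apply: bigcup_measurable => n _; exact: mW.
have mUX : measurable (\bigcup_n X n) by apply: bigcup_measurable => n _; exact: mX.
have UW : (mu (\bigcup_n W n) <= 3%:E * mu G)%E.
  apply: (@le_trans _ _ (\sum_(n <oo) mu (W n))%E).
    by apply: measure_sigma_subadditive => //; exact: mUW.
  apply: (@le_trans _ _ (\sum_(n <oo) 3%:E * mu (X n))%E).
    apply: lee_nneseries => [n _ _|n _]; first exact: measure_ge0.
    by have [_ _ [_ h] _ _] := hWX (idx n).
  rewrite nneseriesZl; last by move=> n _; exact: measure_ge0.
  apply: lee_pmul => //; first by apply: nneseries_ge0 => n _ _; exact: measure_ge0.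
  have -> : (\sum_(n <oo) mu (X n))%E = mu (\bigcup_n X n).
    by apply/cvg_lim => //; exact: measure_sigma_additive.
  apply: le_measure; rewrite ?inE //.
  by move=> r [n _]; exact: XG.
(* The bad radii weigh at most three times the good ones, hence the quarter. *)
have : ((s1 - s0)%:E <= mu G + 3%:E * mu G)%E.
  rewrite -ms; apply: (@le_trans _ _ (mu (G `|` \bigcup_n W n))).
    apply: le_measure; rewrite ?inE //; exact: measurableU.
  apply: (@le_trans _ _ (mu G + mu (\bigcup_n W n))%E); last by rewrite leeD2l.
  exact: measureU2.
have [->|] := eqVneq (mu G) +oo%E; first by rewrite leey.
move=> Goo.
have Gfin : mu G \is a fin_num by rewrite ge0_fin_numE // ltey.
by rewrite -/G -(fineK Gfin) -EFinM -EFinD !lee_fin; lra.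
Qed.

End GoodSet.

(** * Good radii of a monotone function with controlled slopes *)

Section GoodSetMonotone.
Variable R : realType.
Local Notation mu := (@lebesgue_measure R).

Lemma within_continuous_sub (f : R -> R) (a b c d : R) : a <= c -> d <= b ->
  {within `[a, b], continuous f} -> {within `[c, d], continuous f}.
Proof.
by move=> ac db; apply: continuous_subspaceW => x /=; rewrite !in_itv/= => /andP[? ?]; lra.
Qed.

Lemma nondecreasing_ivt (f : R -> R) (a b v : R) : a <= b ->
  {within `[a, b], continuous f} -> f a <= v <= f b -> exists2 c, a <= c <= b & f c = v.
Proof.
move=> ab fc /andP[av vb].
have [|c cab <-] := @IVT R f a b v ab fc.
  by rewrite ge_min le_max av vb orbT.
by exists c.
Qed.

(** The growth by [4 * delta] on [[j0, jm]] ensures that a value within [delta] of an even integer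
    [e], reached after [jm], is preceded within [[j0, j1]] by a complete passage from
    [e - 3 * delta] to [e - delta]. This passage gains [2 * delta], at least as much as the stay
    near [e], and the slope condition compares the durations. *)
Lemma good_set_up (Psi : R -> R) (j0 jm j1 delta : R) : j0 <= jm <= j1 ->
  {in `[j0, j1] &, nondecreasing_fun Psi} -> {within `[j0, j1], continuous Psi} ->
  0 < delta <= 4^-1 -> slope_up 3 j0 j1 Psi -> 4 * delta <= Psi jm - Psi j0 ->
  (((j1 - jm) / 4)%:E <= mu (good_set Psi j0 j1 delta))%E.
Proof.
move=> /andP[j0m jm1] nd ct d01 su grow; have /andP[d0 d1] := d01.
have mono (r s : R) : j0 <= r -> r <= s -> s <= j1 -> Psi r <= Psi s.
  by move=> h1 h2 h3; apply: nd => //; rewrite in_itv/=; lra.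
apply: good_set_charging => // k [r [/andP[r0 r1]]].
set e := 2 * k%:~R; rewrite ltr_norml => /andP[e0 e1].
have P1 := mono jm r j0m r0 r1.
have ctr : {within `[j0, r], continuous Psi} by apply: within_continuous_sub ct.
have [x1 /andP[x10 x1r] x1E] := @nondecreasing_ivt Psi j0 r (e - 3 * delta) ltac:(lra) ctr ltac:(lra).
have [x2 /andP[x20 x2r] x2E] := @nondecreasing_ivt Psi j0 r (e - delta) ltac:(lra) ctr ltac:(lra).
have x12 : x1 <= x2.
  by rewrite leNgt; apply/negP => h; have := mono x2 x1 x20 (ltW h) (le_trans x1r r1); lra.
exists x1, x2; split; [lra|lra| |].
  move=> s /andP[s1 s2]; have x2j := le_trans x2r r1.
  have := mono x1 s x10 s1 (le_trans s2 x2j); have := mono s x2 (le_trans x10 s1) s2 x2j.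
  by move=> h1 h2; rewrite ler0_norm; clear -h1 h2 x1E x2E d0; lra.
move=> y1 y2 /andP[h1 h2] h3; rewrite !ltr_norml => /andP[f1 f2] /andP[f3 f4].
have xy : x2 <= y1.
  rewrite leNgt; apply/negP => h.
  have := mono y1 x2 (le_trans j0m h1) (ltW h) (le_trans x2r r1).
  by clear -x2E f1; lra.
have := su x1 x2 y1 y2; rewrite x10 x12 xy h2 => /(_ isT isT h3).
have -> : Psi x2 - Psi x1 = 2 * delta by clear -x1E x2E; lra.
have : 3 * (x2 - x1) * (Psi y2 - Psi y1) <= 3 * (x2 - x1) * (2 * delta).
  by apply: ler_wpM2l; clear -x12 e0 e1 f1 f2 f3 f4; lra.
move=> h4 h5; have h6 := le_trans h5 h4.
by rewrite ler_pM2r ?mulr_gt0 // in h6.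
Qed.

(** The mirror case: the interval that pays is the passage from [e + delta] to [e + 3 * delta],
    after the bad radii. *)
Lemma good_set_down (Psi : R -> R) (j0 jm j1 delta : R) : j0 <= jm <= j1 ->
  {in `[j0, j1] &, nondecreasing_fun Psi} -> {within `[j0, j1], continuous Psi} ->
  0 < delta <= 4^-1 -> slope_down 3 j0 j1 Psi -> 4 * delta <= Psi j1 - Psi jm ->
  (((jm - j0) / 4)%:E <= mu (good_set Psi j0 j1 delta))%E.
Proof.
move=> /andP[j0m jm1] nd ct d01 su grow; have /andP[d0 d1] := d01.
have mono (r s : R) : j0 <= r -> r <= s -> s <= j1 -> Psi r <= Psi s.
  by move=> h1 h2 h3; apply: nd => //; rewrite in_itv/=; lra.
apply: good_set_charging => // k [r [/andP[r0 r1]]].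
set e := 2 * k%:~R; rewrite ltr_norml => /andP[e0 e1].
have P1 := mono r jm r0 r1 jm1.
have ctr : {within `[r, j1], continuous Psi} by apply: within_continuous_sub ct.
have [x1 /andP[x10 x1r] x1E] := @nondecreasing_ivt Psi r j1 (e + delta) ltac:(lra) ctr ltac:(lra).
have [x2 /andP[x20 x2r] x2E] := @nondecreasing_ivt Psi r j1 (e + 3 * delta) ltac:(lra) ctr ltac:(lra).
have x12 : x1 <= x2.
  by rewrite leNgt; apply/negP => h; have := mono x2 x1 (le_trans r0 x20) (ltW h) x1r; lra.
exists x1, x2; split; [lra|lra| |].
  move=> s /andP[s1 s2]; have jx1 := le_trans r0 x10.
  have := mono x1 s jx1 s1 (le_trans s2 x2r); have := mono s x2 (le_trans jx1 s1) s2 x2r.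
  by move=> h1 h2; rewrite ger0_norm; clear -h1 h2 x1E x2E d0; lra.
move=> y1 y2 /andP[h1 h2] h3; rewrite !ltr_norml => /andP[f1 f2] /andP[f3 f4].
have xy : y2 <= x1.
  rewrite leNgt; apply/negP => h.
  have := mono x1 y2 (le_trans r0 x10) (ltW h) (le_trans h3 jm1).
  by clear -x1E f4; lra.
have := su y1 y2 x1 x2; rewrite h1 h2 xy x12 => /(_ isT isT x2r).
have -> : Psi x2 - Psi x1 = 2 * delta by clear -x1E x2E; lra.
have : 3 * (x2 - x1) * (Psi y2 - Psi y1) <= 3 * (x2 - x1) * (2 * delta).
  by apply: ler_wpM2l; clear -x12 e0 e1 f1 f2 f3 f4; lra.
move=> h4 h5; have h6 := le_trans h5 h4.
by rewrite ler_pM2r ?mulr_gt0 // in h6.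
Qed.

End GoodSetMonotone.

(** * Good radii of the flux in one cell *)

Section FluxCell.
Variable R : realType.
Local Notation mu := (@lebesgue_measure R).
Variables (q a b alpha delta : R) (n : nat) (F Phi : R -> R).
Hypothesis q0 : 0 < q.
Hypothesis bE : b = a + q / 2.
Hypothesis F_nd : forall r s, a <= r -> r <= s -> s <= b -> F r <= F s.
Hypothesis F_cont : {within `[a, b], continuous F}.
Hypothesis F_slow : forall c r, a <= c -> c + 7 * (q / 40) <= b ->
  F (c + 7 * (q / 40)) - F c < 320^-1 -> c + 3 * (q / 40) <= r <= c + 4 * (q / 40) ->
  exists2 p : nat, (p <= n)%N & F r = p%:R.
Hypothesis F_slope : slope_up 3 (a + 11 * (q / 40)) b F \/ slope_down 3 a (a + 9 * (q / 40)) F.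
Hypothesis delta_gt0 : 0 < delta.
Hypothesis delta_alpha : 640 * delta <= alpha.
Hypothesis delta_le : delta <= 4^-1.
Hypothesis delta_odd : forall (p : nat) (k : int), (p <= n)%N ->
  delta <= `|alpha * (1 + 2 * p%:R) - 2 * k%:~R|.
Hypothesis PhiE : forall r, Phi r = alpha * (1 + 2 * F r).

(** In units of [q / 40] the cell has length 20 and the central gap occupies 9 to 11. On the usable
    side, the 7 units next to the gap test for growth. If the flux grows enough there, the 2
    outermost units are charged, which yields a quarter of them, [q / 80]; if not, the central unit
    of the test window, 3 units away from both of its ends, is good. *)
Lemma flux_good_set : ((q / 80)%:E <= mu (good_set Phi a b delta))%E.
Proof.
have [q1 d0 da d4] := And4 q0 delta_gt0 delta_alpha delta_le; have bE' := bE.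
have a0 : 0 < 2 * alpha by lra.
have d01 : 0 < delta <= 4^-1 by rewrite d0.
have PhiB r s : Phi s - Phi r = 2 * alpha * (F s - F r) by rewrite !PhiE; ring.
have fnd (r s : R) : a <= r -> r <= s -> s <= b -> Phi r <= Phi s.
  by move=> hr rs hs; rewrite -subr_ge0 PhiB mulr_ge0 ?(ltW a0) // subr_ge0 F_nd.
have fct c d : a <= c -> d <= b -> {within `[c, d], continuous Phi}.
  move=> hc cd; have /subspace_continuousP h := within_continuous_sub hc cd F_cont.
  have -> : Phi = (fun r => alpha * (1 + 2 * F r)) by apply/funext => r; exact: PhiE.
  apply/subspace_continuousP => x xcd; apply: cvgM; first exact: cvg_cst.
  apply: cvgD; first exact: cvg_cst.
  by apply: cvgM; [exact: cvg_cst|exact: h].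
have mg c d : a <= c -> d <= b -> measurable (good_set Phi c d delta).
  by move=> hc cd; apply: measurable_good_set; exact: fct.
have sub c d : a <= c -> d <= b ->
    (mu (good_set Phi c d delta) <= mu (good_set Phi a b delta))%E.
  move=> h1 h3; apply: le_measure; rewrite ?inE; [exact: mg|exact: mg|].
  move=> r [] /=; rewrite in_itv/= => /andP[? ?] hr; split => //=.
  by rewrite in_itv/=; lra.
have slow c : a <= c -> c + 7 * (q / 40) <= b -> Phi (c + 7 * (q / 40)) - Phi c < 4 * delta ->
    ((q / 80)%:E <= mu (good_set Phi a b delta))%E.
  move=> h1 h2 h3; apply: (@le_trans _ _ (mu `[c + 3 * (q / 40), c + 4 * (q / 40)]%classic)).
    by rewrite lebesgue_measure_itv /= lte_fin; case: ltP => h; rewrite -?EFinB lee_fin; lra.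
  apply: le_measure; rewrite ?inE //; first exact: mg.
  move=> r /=; rewrite in_itv/= => hr; split; first by rewrite /= in_itv/=; lra.
  have [|p pn rp] := F_slow h1 h2 _ hr.
    (* The thresholds match: [4 * delta] is at most [2 * alpha / 320]. *)
    rewrite -(ltr_pM2l a0) -PhiB; apply: (lt_le_trans h3); lra.
  by move=> k; rewrite /= PhiE rp; exact: delta_odd.
have affine C c d : slope_up C c d F -> slope_up C c d Phi.
  move=> h x1 x2 y1 y2 h1 h2 h3; rewrite !PhiB !(mulrCA _ (2 * alpha)) ler_pM2l //.
  exact: h.
have affine' C c d : slope_down C c d F -> slope_down C c d Phi.
  move=> h x1 x2 y1 y2 h1 h2 h3; rewrite !PhiB !(mulrCA _ (2 * alpha)) ler_pM2l //.
  exact: h.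
have ndin c d : a <= c -> d <= b -> {in `[c, d] &, nondecreasing_fun Phi}.
  by move=> hc hd r s; rewrite !in_itv/= => /andP[r1 _] /andP[_ s1] rs; apply: fnd; rewrite // ?(le_trans hc) // (le_trans s1).
have [up|down] := F_slope.
  set z := a + 11 * (q / 40) in up *.
  have zE : z = a + 11 * (q / 40) by [].
  have [h|h] := ltP (Phi (z + 7 * (q / 40)) - Phi z) (4 * delta).
    by apply: (slow z) => //; lra.
  have [az zm mb] : [/\ a <= z, z <= z + 7 * (q / 40) <= b & b <= b] by split; lra.
  apply: le_trans (sub z b az mb).
  apply: le_trans (good_set_up zm (ndin z b az mb) (fct z b az mb) d01 (affine _ _ _ up) h).
  by rewrite lee_fin; lra.
set z := a + 9 * (q / 40) in down *; set w := a + 2 * (q / 40).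
have zE : z = a + 9 * (q / 40) by []; have wE : w = a + 2 * (q / 40) by [].
have [h|h] := ltP (Phi (w + 7 * (q / 40)) - Phi w) (4 * delta).
  by apply: (slow w) => //; lra.
have E9 : w + 7 * (q / 40) = z by lra.
rewrite E9 in h.
have [aa wm zb] : [/\ a <= a, a <= w <= z & z <= b] by split; lra.
apply: le_trans (sub a z aa zb).
apply: le_trans (good_set_down wm (ndin a z aa zb) (fct a z aa zb) d01 (affine' _ _ _ down) h).
by rewrite lee_fin; lra.
Qed.

End FluxCell.

(** * The sum of the covered fractions *)

Section TotalCover.
Variable R : realType.
Variables (q : R) (I : finType) (Y : I -> R * R).
Hypothesis q_gt0 : 0 < q.

Definition total_cover (r : R) : R := \sum_i cover q (Y i) r.

Lemma total_cover_nd (r s : R) : 3 * q <= r -> r <= s -> total_cover r <= total_cover s.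
Proof.
move=> hr rs; apply: ler_sum => i _; rewrite -subr_ge0.
by have /andP[] := @cover_lip R q (Y i) q_gt0 r s ltac:(lra).
Qed.

Lemma total_cover_cont (a b : R) : 3 * q <= a -> a <= b -> {within `[a, b], continuous total_cover}.
Proof.
move=> ha ab; have q0 := q_gt0.
pose L := #|I|%:R * (11 / 5 / (pi * q)).
have L0 : 0 <= L by rewrite mulr_ge0 // divr_ge0 // mulr_ge0 ?pi_ge0 // ltW.
have lip (r s : R) : a <= r -> r <= s -> total_cover s - total_cover r <= L * (s - r).
  move=> hr hs; rewrite /total_cover -sumrB /L -mulrA mulr_natl -sumr_const.
  by apply: ler_sum => i _; have /andP[] := @cover_lip R q (Y i) q0 r s ltac:(lra).
apply/subspace_continuousP => x /=; rewrite in_itv/= => /andP[xa xb].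
apply/cvgrPdist_le => e e0; rewrite near_withinE.
(* [L] vanishes when there is no disk, hence the denominator [L + 1]. *)
have L1 : 0 < L + 1 by lra.
near=> s; move=> /=; rewrite in_itv/= => /andP[sa sb].
have : `|x - s| < e / (L + 1).
  by near: s; apply: cvgr_dist_lt => //; rewrite divr_gt0.
rewrite ltr_pdivlMr // => h.
have k0 := normr_ge0 (x - s).
apply: (@le_trans _ _ (L * `|x - s|)); last by lra.
have [xs|xs] := leP x s.
  rewrite !ler0_norm ?subr_le0 //; last by apply: total_cover_nd => //; exact: le_trans xa.
  by rewrite !opprB; apply: lip.
rewrite !ger0_norm ?subr_ge0 //; try exact: ltW; last by apply: total_cover_nd; [exact: le_trans sa|exact: ltW].
by apply: lip => //; exact: ltW.
Unshelve. all: by end_near. Qed.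

(* A disk meeting the circle of radius [r] would make [total_cover] grow too much. *)
Lemma total_cover_slow (c r : R) : 3 * q <= c ->
  total_cover (c + 7 * (q / 40)) - total_cover c < 320^-1 ->
  c + 3 * (q / 40) <= r <= c + 4 * (q / 40) ->
  exists2 p : nat, (p <= #|I|)%N & total_cover r = p%:R.
Proof.
move=> hc F7 /andP[r1 r2].
have q0 := q_gt0.
pose r' := r - 3 / 40 * q; pose r'' := r + 3 / 40 * q.
have [c1 c2 c3] : [/\ c <= r', r' <= r'' & r'' <= c + 7 * (q / 40)].
  by rewrite /r' /r''; clear -q0 r1 r2; split; lra.
have r'q : 3 * q <= r' by exact: le_trans c1.
have r0 : 0 < r by clear -q0 r1 hc; lra.
have lo i : 0 <= cover q (Y i) r'' - cover q (Y i) r'.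
  by have /andP[] := @cover_lip R q (Y i) q0 r' r'' ltac:(by rewrite r'q).
have alt i : cover q (Y i) r = (nat_of_bool (enorm (Y i) + q <= r)%R)%:R.
  have [h|h] := leP (enorm (Y i) + q) r; first exact: cover_near.
  have [h'|h'] := leP r (enorm (Y i) - q); first exact: cover_far.
  have h1 := @cover_grow R q (Y i) q0 r ltac:(by apply/andP; split; clear -h h'; lra) r'q.
  have h2 : cover q (Y i) r'' - cover q (Y i) r' <= total_cover r'' - total_cover r'.
    rewrite /total_cover -sumrB (bigD1 i) //= lerDl.
    by apply: sumr_ge0 => j _; exact: lo.
  have h3 := total_cover_nd hc c1.
  have h4 := total_cover_nd (le_trans r'q c2) c3.
  have := le_lt_trans (le_trans h1 h2) (le_lt_trans (lerB h4 h3) F7).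
  by rewrite ltxx.
exists #|[pred i : I | (enorm (Y i) + q <= r)%R]|; first exact: max_card.
rewrite /total_cover (eq_bigr _ (fun i _ => alt i)) -natr_sum -sum1_card [in RHS]big_mkcond /=.
by congr (_%:R); apply: eq_bigr => i _; rewrite inE; case: ifP.
Qed.

Lemma total_cover_slope (a b : R) : 3 * q <= a -> b = a + q / 2 ->
  slope_up 3 (a + 11 * (q / 40)) b total_cover \/ slope_down 3 a (a + 9 * (q / 40)) total_cover.
Proof.
move=> ha bE; have q0 := q_gt0.
apply: (@slope_sum_dichotomy R I (fun i => cover q (Y i))); [clear -q0; lra|clear -q0; lra| | |].
- by rewrite bE; clear -q0; lra.
- move=> i r s; rewrite !in_itv/= => /andP[r1 _] _ rs; rewrite -subr_ge0.
  have hr : 3 * q <= r <= s by rewrite (le_trans ha r1).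
  by have /andP[] := cover_lip (Y i) q0 hr.
- by move=> i; exact: cover_cell.
Qed.

End TotalCover.

(** * From covered fractions to the flux and to [rho] *)

Section Flux.
Variable R : realType.
Local Notation mu := (@lebesgue_measure R).

Lemma alphaN_set_lb (alpha : R) (p : nat) :
  lbound [set `|(2 * p + 1)%:R * alpha - 2 * k%:~R| | k in [set: int]] 0.
Proof. by move=> _ [k _ <-]. Qed.

Lemma alphaN_le (alpha : R) (N p : nat) (k : int) : (p <= N - 2)%N ->
  alphaN alpha N <= `|alpha * (1 + 2 * p%:R) - 2 * k%:~R|.
Proof.
move=> pN; apply: (@le_trans _ _
    (inf [set `|(2 * p + 1)%:R * alpha - 2 * k%:~R| | k in [set: int]])).
  apply: ge_inf; last by exists p.
  exists 0 => _ [p' _ <-]; apply: lb_le_inf; last exact: alphaN_set_lb.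
  by exists `|(2 * p' + 1)%:R * alpha - 2 * 0%:~R|; exists 0.
apply: ge_inf; first by exists 0; exact: alphaN_set_lb.
by exists k => //; congr `|_ - _|; rewrite natrD natrM; ring.
Qed.

Lemma alphaN_ge0 (alpha : R) (N : nat) : 0 <= alphaN alpha N.
Proof.
apply: lb_le_inf.
  by exists (inf [set `|(2 * 0 + 1)%:R * alpha - 2 * k%:~R| | k in [set: int]]); exists 0%N.
move=> _ [p _ <-]; apply: lb_le_inf; last exact: alphaN_set_lb.
by exists `|(2 * p + 1)%:R * alpha - 2 * 0%:~R|; exists 0.
Qed.

(** Even integers have gaps of length 2, so some even integer is within 2 below [alpha]. This keeps
    [alphaN / 640] under the threshold 1/4. *)
Lemma alphaN_le2 (alpha : R) (N : nat) : alphaN alpha N <= 2.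
Proof.
apply: (le_trans (@alphaN_le alpha N 0 (Num.floor (alpha / 2)) (leq0n _))).
rewrite mulr0 addr0 mulr1.
have /andP[h1 h2] := floor_itv (alpha / 2).
by rewrite intrD in h2; rewrite ger0_norm; lra.
Qed.

Lemma rho_ge (alpha q : R) (N : nat) (y : 'I_(N - 2) -> R * R) (r d : R) : 0 <= d ->
  (forall k : int, d <= `|Phihat alpha q y r - 2 * k%:~R|) -> d ^+ 2 <= rho alpha q y r.
Proof.
move=> d0 h; apply: lb_le_inf.
  by exists (`|Phihat alpha q y r - 2 * 0%:~R| ^+ 2); exists 0.
by move=> _ [k _ <-]; rewrite lerXn2r ?nnegrE.
Qed.

Lemma rho_ge0 (alpha q : R) (N : nat) (y : 'I_(N - 2) -> R * R) (r : R) : 0 <= rho alpha q y r.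
Proof. by have := @rho_ge alpha q N y r 0 (lexx 0) (fun=> normr_ge0 _); rewrite expr0n. Qed.

Lemma rho_ge_point (alpha : R) (N : nat) (y : 'I_(N - 2) -> R * R) (r : R) :
  alphaN alpha N ^+ 2 <= rho alpha 0 y r.
Proof.
apply: rho_ge; first exact: alphaN_ge0.
move=> k; rewrite /Phihat eqxx; apply: alphaN_le.
by rewrite -[X in (_ <= X)%N](card_ord (N - 2)) max_card.
Qed.

(** From radius [3 * q] on, the central disk is covered. It contributes the 1 that makes the flux an
    odd multiple of [alpha] whenever the other fractions add up to an integer. *)
Lemma PhihatE (alpha q : R) (N : nat) (y : 'I_(N - 2) -> R * R) (r : R) : 0 < q -> 3 * q <= r ->
  Phihat alpha q y r = alpha * (1 + 2 * total_cover q y r).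
Proof.
move=> q0 hr; rewrite /Phihat gt_eqF //; congr (_ * (_ + _)).
apply: (@cover_near R (q / 2) (origin R)); first by rewrite divr_gt0.
by rewrite /enorm /= expr0n addr0 sqrtr0; lra.
Qed.

Lemma rho_good_cell (alpha q a b : R) (N : nat) (y : 'I_(N - 2) -> R * R) :
  0 < q -> 3 * q <= a -> b = a + q / 2 -> 0 < alphaN alpha N ->
  exists E : set R, [/\ measurable E, E `<=` `[a, b], ((q / 80)%:E <= mu E)%E &
    forall r, E r -> (alphaN alpha N / 640) ^+ 2 <= rho alpha q y r].
Proof.
move=> q0 ha bE A0; set A := alphaN alpha N in A0 *.
pose delta := A / 640.
have A2 : A <= 2 := alphaN_le2 alpha N.
have Aa : A <= `|alpha|.
  by have := @alphaN_le alpha N 0 0 (leq0n _); rewrite !mulr0 subr0 addr0 mulr1.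
have d01 : 0 < delta <= 4^-1 by rewrite /delta; lra.
(* With [|alpha|] in place of [alpha] the flux is nondecreasing; since the even integers are
   symmetric about 0, the distance to them does not change. *)
pose Phi r := `|alpha| * (1 + 2 * total_cover q y r).
have sgn (t d : R) : (forall k : int, d <= `|alpha * t - 2 * k%:~R|) <->
    (forall k : int, d <= `| `|alpha| * t - 2 * k%:~R|).
  have [a0|a0] := leP 0 alpha; first by rewrite ger0_norm.
  have E (l : int) : `| `|alpha| * t - 2 * l%:~R| = `|alpha * t - 2 * (- l)%:~R|.
    have Nl : (- l)%:~R = - l%:~R :> R by rewrite mulrNz.
    by rewrite Nl (ltr0_norm a0) -[RHS]normrN; congr (Num.norm _); ring.
  by split => h l; [rewrite E|rewrite -[l]opprK -E]; exact: h.
have ab : a <= b by lra.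
have nd r s : a <= r -> r <= s -> s <= b -> total_cover q y r <= total_cover q y s.
  by move=> hr rs _; apply: total_cover_nd => //; exact: le_trans hr.
have cont := @total_cover_cont R q _ y q0 a b ha ab.
have slow c r : a <= c -> c + 7 * (q / 40) <= b ->
    total_cover q y (c + 7 * (q / 40)) - total_cover q y c < 320^-1 ->
    c + 3 * (q / 40) <= r <= c + 4 * (q / 40) ->
    exists2 p : nat, (p <= N - 2)%N & total_cover q y r = p%:R.
  move=> hc _ h hr.
  have [p] := @total_cover_slow R q _ y q0 c r (le_trans ha hc) h hr.
  by rewrite card_ord; exists p.
have slope := @total_cover_slope R q _ y q0 a b ha bE.
have odd (p : nat) (k : int) : (p <= N - 2)%N -> delta <= `| `|alpha| * (1 + 2 * p%:R) - 2 * k%:~R|.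
  move=> pN; apply: (sgn (1 + 2 * p%:R) delta).1 => l.
  by apply: le_trans (alphaN_le alpha l pN); rewrite /delta -/A; lra.
have [d0 d4] := andP d01.
have dA : 640 * delta <= `|alpha| by apply: le_trans Aa; rewrite /delta; lra.
have PhiE r : Phi r = `|alpha| * (1 + 2 * total_cover q y r) by [].
have := flux_good_set q0 bE nd cont slow slope d0 dA d4 odd PhiE.
move=> h; exists (good_set Phi a b delta); split => //.
- apply: measurable_good_set; rewrite /Phi; move/subspace_continuousP: cont => cont.
  apply/subspace_continuousP => x xab; apply: cvgM; first exact: cvg_cst.
  apply: cvgD; first exact: cvg_cst.
  by apply: cvgM; [exact: cvg_cst|exact: cont].
- by move=> r [].
move=> r [] /=; rewrite in_itv/= => /andP[ra _] hr.
apply: rho_ge; first exact: ltW.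
rewrite PhihatE //; last exact: le_trans ra.
by apply: (sgn _ _).2 => k; exact: hr.
Qed.

End Flux.

(** * Cutoff functions of class C^1 *)

Section WeakDerivative.
Variable R : realType.
Local Notation mu := (@lebesgue_measure R).

(** Building block of quadratic splines, whose derivatives are continuous, as [test_fun]
    requires. *)
Definition pos_sqr (w : R) : R := Num.max w 0 ^+ 2.

Lemma max0_cases (w : R) : (0 <= w /\ Num.max w 0 = w) \/ (w <= 0 /\ Num.max w 0 = 0).
Proof. by have [h|h] := leP 0 w; [left|right; split => //; exact: ltW]. Qed.

#[local] Instance is_derive_pos_sqr (x : R) : is_derive x (1 : R) pos_sqr (2 * Num.max x 0).
Proof.
(* A remainder of at most [h^2] gives the derivative at every point, including the knot 0. *)
have bd (h : R) : `|pos_sqr (h + x) - pos_sqr x - 2 * Num.max x 0 * h| <= `|h| * `|h|.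
  rewrite -normrM -expr2 ger0_norm ?sqr_ge0 // /pos_sqr.
  case: (max0_cases (h + x)) => -[h1 ->]; case: (max0_cases x) => -[h2 ->];
    rewrite ler_norml; apply/andP; split; nra.
have lim : h^-1 *: (pos_sqr (h *: (1 : R) + x) - pos_sqr x) @[h --> (0 : R)^'] --> 2 * Num.max x 0.
  apply/cvgrPdist_le => e e0; near=> h.
  have h0 : h != 0 by near: h; exact: nbhs_dnbhs_neq.
  rewrite -[X in `|X - _|](mulfK h0) [X in `|_ - X|]mulrC -mulrBl normrM normfV.
  rewrite ler_pdivrMr ?normr_gt0 // -normrN opprB [h *: _]mulr1.
  apply: (le_trans (bd h)); rewrite ler_pM2r ?normr_gt0 //.
  by near: h; apply: dnbhs0_le.
apply: DeriveDef; first by apply/cvg_ex; exists (2 * Num.max x 0).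
exact/cvg_lim.
Unshelve. all: by end_near. Qed.

(** The quadratic spline with knots 0, 1/2 and 1 that climbs from 0 to 1; its derivative [hat] is
    the tent of height 2. *)
Definition step (w : R) : R := 2 * (pos_sqr w - 2 * pos_sqr (w - 2^-1) + pos_sqr (w - 1)).
Definition hat (w : R) : R :=
  4 * (Num.max w 0 - 2 * Num.max (w - 2^-1) 0 + Num.max (w - 1) 0).

Lemma step_le0 w : w <= 0 -> step w = 0 /\ hat w = 0.
Proof.
move=> h; rewrite /step /hat /pos_sqr.
case: (max0_cases w) => -[h1 ->]; case: (max0_cases (w - 2^-1)) => -[h2 ->];
  case: (max0_cases (w - 1)) => -[h3 ->]; split; nra.
Qed.

Lemma step_ge1 w : 1 <= w -> step w = 1 /\ hat w = 0.
Proof.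
move=> h; rewrite /step /hat /pos_sqr.
case: (max0_cases w) => -[h1 ->]; case: (max0_cases (w - 2^-1)) => -[h2 ->];
  case: (max0_cases (w - 1)) => -[h3 ->]; split; nra.
Qed.

Lemma step_itv w : 0 <= step w <= 1.
Proof.
rewrite /step /pos_sqr.
by case: (max0_cases w) => -[h1 ->]; case: (max0_cases (w - 2^-1)) => -[h2 ->];
  case: (max0_cases (w - 1)) => -[h3 ->]; apply/andP; split; nra.
Qed.

Lemma hat_itv w : 0 <= hat w <= 2.
Proof.
rewrite /hat.
by case: (max0_cases w) => -[h1 ->]; case: (max0_cases (w - 2^-1)) => -[h2 ->];
  case: (max0_cases (w - 1)) => -[h3 ->]; apply/andP; split; lra.
Qed.

(* A C^1 transition from 0 to 1 on [[c - e, c + e]] and its derivative. *)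
Definition ramp (c e z : R) : R := step ((z - c + e) / (2 * e)).
Definition bump (c e z : R) : R := hat ((z - c + e) / (2 * e)) / (2 * e).

#[local] Instance is_derive_step (w : R) : is_derive w (1 : R) step (hat w).
Proof.
have shift (t : R) : is_derive w (1 : R) (fun w => pos_sqr (w - t)) (2 * Num.max (w - t) 0).
  have -> : (fun w => pos_sqr (w - t)) = pos_sqr \o (fun w => w - t) by [].
  have := @is_derive1_comp R pos_sqr (fun w => w - t) w _ _ (is_derive_pos_sqr (w - t)).
  move=> /(_ 1); rewrite mulr1; apply.
  by apply: is_derive_eq; rewrite subr0.
have d1 := shift (2^-1); have d2 := shift 1.
rewrite /step /hat; apply: is_derive_eq.
rewrite /GRing.scale /=; ring.
Qed.

#[local] Instance is_derive_ramp (c e z : R) : is_derive z (1 : R) (ramp c e) (bump c e z).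
Proof.
rewrite /ramp /bump.
have := @is_derive1_comp R step (fun z => (z - c + e) / (2 * e)) z (hat ((z - c + e) / (2 * e)))
  (2 * e)^-1 (is_derive_step _).
apply; apply: is_derive_eq.
by rewrite /GRing.scale /=; ring.
Qed.

Lemma derive1_ramp (c e : R) : derive1 (ramp c e) = bump c e.
Proof. by apply/funext => z; rewrite derive1E; have [_ ->] := is_derive_ramp c e z. Qed.

Lemma continuous_ramp (c e : R) : continuous (ramp c e).
Proof.
move=> x; apply: differentiable_continuous; apply/derivable1_diffP.
by have [] := is_derive_ramp c e x.
Qed.

Lemma continuous_bump (c e : R) : continuous (bump c e).
Proof.
have cm (t : R) : continuous (fun w : R => Num.max (w - t) 0).
  have -> : (fun w => Num.max (w - t) 0) = (fun w : R => (w - t + `|w - t|) / 2).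
    by apply/funext => w; case: (max0_cases (w - t)) => -[h ->];
      rewrite ?(ger0_norm h) ?(ler0_norm h); field.
  have ct : continuous (fun w : R => w - t).
    by move=> w; apply: cvgB; [exact: cvg_id|exact: cvg_cst].
  move=> w; apply: cvgM; last exact: cvg_cst.
  by apply: cvgD; [exact: ct|apply: cvg_norm; exact: ct].
have ch : continuous hat.
  move=> w; apply: cvgM; first exact: cvg_cst.
  apply: cvgD; last exact: cm.
  apply: cvgB; last by apply: cvgM; [exact: cvg_cst|exact: cm].
  by have := cm 0 w; rewrite /continuous_at subr0; under eq_fun do rewrite subr0.
move=> z; apply: cvgM; last exact: cvg_cst.
apply: (@continuous_comp _ _ _ (fun z : R => (z - c + e) / (2 * e)) hat); last exact: ch.
apply: cvgM; last exact: cvg_cst.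
by apply: cvgD; [apply: cvgB; [exact: cvg_id|exact: cvg_cst]|exact: cvg_cst].
Qed.

Lemma ramp_left (c e z : R) : 0 < e -> z <= c - e -> ramp c e z = 0 /\ bump c e z = 0.
Proof.
move=> e0 h; have [] := @step_le0 ((z - c + e) / (2 * e)).
  by rewrite pmulr_lle0 ?invr_gt0; lra.
by rewrite /ramp /bump => -> ->; rewrite mul0r.
Qed.

Lemma ramp_right (c e z : R) : 0 < e -> c + e <= z -> ramp c e z = 1 /\ bump c e z = 0.
Proof.
move=> e0 h; have [] := @step_ge1 ((z - c + e) / (2 * e)).
  by rewrite ler_pdivlMr; lra.
by rewrite /ramp /bump => -> ->; rewrite mul0r.
Qed.

Lemma bump_itv (c e z : R) : 0 < e -> 0 <= bump c e z <= e^-1.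
Proof.
move=> e0; have /andP[h1 h2] := hat_itv ((z - c + e) / (2 * e)).
apply/andP; split; first by rewrite divr_ge0 // mulr_ge0 // ltW.
by rewrite /bump ler_pdivrMr ?mulr_gt0 // mulrCA mulVf ?mulr1 // gt_eqF.
Qed.

Lemma integral_bump (c e a b : R) : 0 < e -> a <= c - e -> c + e <= b ->
  (\int[mu]_(z in `[a, b]) (bump c e z)%:E = 1)%E.
Proof.
move=> e0 ha hb; rewrite (@continuous_FTC2 R _ (ramp c e)).
- have [-> _] := @ramp_left c e a e0 ha; have [-> _] := @ramp_right c e b e0 hb.
  by rewrite sube0.
- lra.
- exact/continuous_subspaceT/continuous_bump.
- split; first by move=> x _; have [] := is_derive_ramp c e x.
    exact/cvg_at_right_filter/continuous_ramp.
  exact/cvg_at_left_filter/continuous_ramp.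
- by move=> x _; rewrite derive1_ramp.
Qed.

End WeakDerivative.

(** * Averages against bumps at Lebesgue points *)

Section Mollification.
Variable R : realType.
Local Notation mu := (@lebesgue_measure R).

Lemma bump_out (c e z : R) : 0 < e -> ~ ball c e z -> bump c e z = 0.
Proof.
move=> e0; rewrite -ball_normE /= => /negP; rewrite -leNgt ler_normr => /orP[h|h].
  by have [] := @ramp_left _ c e z e0; first lra.
by have [] := @ramp_right _ c e z e0; first lra.
Qed.

Lemma measurable_bump (D : set R) (c e : R) : measurable_fun D (bump c e).
Proof. by apply: measurable_funTS; apply: continuous_measurable_fun; exact: continuous_bump. Qed.

Lemma integrable_bump (f : R -> R) (D : set R) (c e : R) : measurable D -> 0 < e ->
  mu.-integrable D (EFin \o f) -> mu.-integrable D (fun z => (f z * bump c e z)%:E).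
Proof.
move=> mD e0 fi.
rewrite (_ : (fun z => _) = ((EFin \o f) \* (EFin \o bump c e))%E); last first.
  by apply/funext => z /=; rewrite EFinM.
apply: (@integrableMl _ _ _ mu D mD (EFin \o f) (bump c e) fi); first exact: measurable_bump.
exists e^-1; split; first exact: num_real.
move=> M hM z _ /=; have /andP[h1 h2] := bump_itv c z e0.
by rewrite ger0_norm //; exact: le_trans (ltW hM).
Qed.

Lemma integrable_cst_itv (a b k : R) : mu.-integrable `[a, b] (EFin \o (fun=> k)).
Proof.
have moo : (mu `[a, b]%classic < +oo)%E.
  by rewrite lebesgue_measure_itv /=; case: ifP => _; rewrite -?EFinB ltry.
apply: measurable_bounded_integrable => //.
by exists `|k|; split => // M hM z _ /=; exact: ltW.
Qed.

(** The bump has mass 1 and is at most [e^-1] on a ball of measure [2 * e], hence the factor 2 over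
    the mean deviation [davg]. Extending [f] by zero puts it in the form required for Lebesgue
    points of functions on the line. *)
Lemma bump_average_le (f : R -> R) (a b c e : R) : 0 < e -> a <= c - e -> c + e <= b ->
  mu.-integrable `[a, b] (EFin \o f) ->
  (`| \int[mu]_(z in `[a, b]) (f z * bump c e z)%:E - (f c)%:E | <=
   2%:E * davg (f \_ `[a, b]) c e)%E.
Proof.
move=> e0 ha hb fi.
have mf : measurable_fun `[a, b] f by apply/measurable_EFinP; exact: measurable_int fi.
have ci := integrable_cst_itv a b (f c).
have cE : (f c)%:E = (\int[mu]_(z in `[a, b]) (f c * bump c e z)%:E)%E.
  under eq_integral do rewrite EFinM.
  rewrite integralZl // ?(@integral_bump _ c e a b) ?mule1 //.
  rewrite (_ : (fun z => _) = (fun z => (1 * bump c e z)%:E)).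
    by apply: integrable_bump => //; exact: integrable_cst_itv.
  by apply/funext => z; rewrite mul1r.
rewrite cE -integralB //; try exact: integrable_bump.
apply: (le_trans (le_abse_integral _ _ _)) => //.
  by apply: emeasurable_funB; apply/measurable_EFinP; apply: measurable_funM => //;
    exact: measurable_bump.
have mfR : measurable_fun setT (f \_ `[a, b]) by apply/(measurable_restrictT _ _).1.
have dE : (2%:E * davg (f \_ `[a, b]) c e = \int[mu]_(z in ball c e)
    (e^-1%:E * `|(center ((f \_ `[a, b]) c) \o (f \_ `[a, b])) z|%:E))%E.
  rewrite /davg /iavg lebesgue_measure_ball ?ltW // ge0_integralZl //; last 3 first.
  - exact: measurable_ball.
  - apply/measurable_EFinP/measurableT_comp => //; apply: measurable_funTS.
    exact: measurable_funB.
  - by rewrite lee_fin invr_ge0 ltW.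
  rewrite muleA inver mulrn_eq0 /= gt_eqF // -EFinM; congr (_%:E * _)%E.
  by rewrite -[e *+ 2]mulr_natl invfM mulrA divff // mul1r.
rewrite dE [leRHS]integral_mkcond [leLHS]integral_mkcond.
apply: ge0_le_integral => //.
- by move=> z _; apply: erestrict_ge0.
- apply/(measurable_restrictT _ _).1 => //; apply: measurableT_comp => //.
  by apply: emeasurable_funB; apply/measurable_EFinP; apply: measurable_funM => //;
    exact: measurable_bump.
- apply/(measurable_restrictT _ _).1; first exact: measurable_ball.
  apply: measurable_funeM; apply/measurable_EFinP/measurableT_comp => //.
  by apply: measurable_funTS; exact: measurable_funB.
move=> z _; rewrite [leLHS]patchE [leRHS]patchE; case: ifPn => zab; last first.
  case: ifPn => // _; apply: mule_ge0; rewrite lee_fin //.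
  by rewrite invr_ge0 ltW.
have zab' : `[a, b]%classic z by rewrite -inE.
have cab : `[a, b]%classic c by rewrite /= in_itv/=; lra.
have fE w : `[a, b]%classic w -> (f \_ `[a, b]) w = f w by move=> wab; rewrite patchE mem_set.
have -> : (center ((f \_ `[a, b]) c) \o f \_ `[a, b]) z = f z - f c by rewrite /= !fE.
rewrite /= -mulrBl.
case: ifPn => [_|/negP]; last first.
  by rewrite inE => hz; rewrite bump_out // mulr0 normr0.
rewrite lee_fin normrM mulrC; apply: ler_wpM2r => //.
by have /andP[h1 h2] := bump_itv c z e0; rewrite ger0_norm.
Qed.

Lemma bump_average_cvg (f : R -> R) (a b c : R) (e : nat -> R) :
  (forall n, 0 < e n) -> (forall n, a <= c - e n) -> (forall n, c + e n <= b) ->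
  e n @[n --> \oo] --> 0 -> mu.-integrable `[a, b] (EFin \o f) ->
  lebesgue_pt (f \_ `[a, b]) c ->
  (\int[mu]_(z in `[a, b]) (f z * bump c (e n) z)%:E @[n --> \oo] --> (f c)%:E)%E.
Proof.
move=> e0 ha hb ecvg fi lp.
apply/(sube_cvg0 _ _).1 => //; apply/cvg_abse0P.
apply: (@squeeze_cvge _ _ _ _ (cst 0%E) _ (fun n => 2%:E * davg (f \_ `[a, b]) c (e n))%E).
- apply: nearW => n; rewrite abse_ge0 /=; exact: bump_average_le.
- exact: cvg_cst.
rewrite -[X in _ --> X](mule0 2%:E); apply: cvgeZl => //.
have : e n @[n --> \oo] --> (0 : R)^'+.
  move=> A /= [d d0 dA]; have /cvgrPdist_lt /(_ _ d0) := ecvg.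
  apply: filterS => n h; apply: dA => //.
by move=> h; exact: (cvg_comp _ _ h lp).
Qed.

End Mollification.

(** * The fundamental theorem of calculus for weak derivatives *)

Section AbsoluteContinuity.
Variable R : realType.
Local Notation mu := (@lebesgue_measure R).

Lemma integral_support (A B : set R) (h : R -> R) : B `<=` A ->
  (forall z, ~ B z -> h z = 0) -> (\int[mu]_(z in A) (h z)%:E = \int[mu]_(z in B) (h z)%:E)%E.
Proof.
move=> BA h0; rewrite [LHS]integral_mkcond [RHS]integral_mkcond; apply: eq_integral => z _.
have [Bz|Bz] := pselect (B z).
  by rewrite !patchE !mem_set //; exact: BA.
by rewrite !patchE h0 // (memNset Bz); case: ifP.
Qed.

Variables (a b : R) (u g : R -> R).
Hypothesis wd : weak_deriv a b u g.

(** The difference of two ramps is a C^1 version of the indicator of [[s, x]]. Tested against it,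
    the weak derivative relates averages of [u] near [s] and [x] to an integral of [g]. *)
Lemma test_fun_ramps (s x e : R) : 0 < e -> a < s - e -> s <= x -> x + e < b ->
  test_fun a b (fun z => ramp s e z - ramp x e z) /\
  derive1 (fun z => ramp s e z - ramp x e z) = (fun z => bump s e z - bump x e z).
Proof.
move=> e0 as_ sx xb.
have d (z : R) : is_derive z (1 : R) (fun z => ramp s e z - ramp x e z) (bump s e z - bump x e z).
  exact: (is_deriveB (is_derive_ramp s e z) (is_derive_ramp x e z)).
have dE : derive1 (fun z => ramp s e z - ramp x e z) = (fun z => bump s e z - bump x e z).
  by apply/funext => z; rewrite derive1E; have [_ ->] := d z.
split=> //; split; first by move=> z; have [] := d z.
split; first by rewrite dE => z; apply: cvgB; exact: continuous_bump.
exists (s - e), (x + e); split => //; split => // z [h|h].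
  have [|-> _] := @ramp_left _ s e z e0; first exact: ltW.
  have [|-> _] := @ramp_left _ x e z e0; [lra|by rewrite subrr].
have [|-> _] := @ramp_right _ s e z e0; first lra.
have [|-> _] := @ramp_right _ x e z e0; [lra|by rewrite subrr].
Qed.

(** A ramp takes the value 1/2 at its center, so convergence to the indicator is claimed away from
    [s] and [x]; two points do not matter in the integral. *)
Lemma ramps_cvg (s x z : R) (e : nat -> R) : (forall n, 0 < e n) -> e n @[n --> \oo] --> 0 ->
  z != s -> z != x -> s <= x ->
  ramp s (e n) z - ramp x (e n) z @[n --> \oo] --> (\1_(`[s, x]%classic) z : R).
Proof.
move=> e0 ecvg zs zx sx.
have small d : 0 < d -> \forall n \near \oo, e n <= d.
  move=> d0; have /cvgrPdist_le /(_ _ d0) := ecvg.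
  by apply: filterS => n; rewrite sub0r normrN gtr0_norm.
apply: cvg_near_cst; rewrite indicE.
have [h1|h1] := ltP z s.
  rewrite memNset; last by rewrite /= in_itv/=; move/andP => [? _]; lra.
  have d0 : 0 < s - z by lra.
  apply: filterS (small _ d0) => n hn.
  have [|-> _] := @ramp_left _ s (e n) z (e0 n); first lra.
  by have [|-> _] := @ramp_left _ x (e n) z (e0 n); [lra|rewrite subrr].
have {}h1 : s < z by rewrite lt_def zs.
have [h2|h2] := ltP x z.
  rewrite memNset; last by rewrite /= in_itv/=; move/andP => [_ ?]; lra.
  have d0 : 0 < z - x by lra.
  apply: filterS (small _ d0) => n hn.
  have [|-> _] := @ramp_right _ s (e n) z (e0 n); first lra.
  by have [|-> _] := @ramp_right _ x (e n) z (e0 n); [lra|rewrite subrr].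
have {}h2 : z < x by rewrite lt_def eq_sym zx.
rewrite mem_set; last by rewrite /= in_itv/=; apply/andP; split; exact: ltW.
have d0 : 0 < z - s by lra.
have d1 : 0 < x - z by lra.
apply: filterS2 (small _ d0) (small _ d1) => n hn hn'.
have [|-> _] := @ramp_right _ s (e n) z (e0 n); first lra.
by have [|-> _] := @ramp_left _ x (e n) z (e0 n); [lra|rewrite subr0].
Qed.

Variables (c0 d0 : R).
Hypotheses (ac : a < c0) (db : d0 < b).

Let ui : mu.-integrable `[c0, d0] (EFin \o u). Proof. by have [/(_ c0 d0 ac db)[]] := wd. Qed.
Let gi : mu.-integrable `[c0, d0] (EFin \o g). Proof. by have [/(_ c0 d0 ac db)[]] := wd. Qed.

Lemma lebesgue_pt_increment (s x : R) : c0 < s -> s < x -> x < d0 ->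
  lebesgue_pt (u \_ `[c0, d0]) s -> lebesgue_pt (u \_ `[c0, d0]) x ->
  ((u x - u s)%:E = \int[mu]_(z in `[s, x]) (g z)%:E)%E.
Proof.
move=> cs sx xd ls lx; have ac' := ac; have db' := db.
pose e1 := Num.min (s - c0) (d0 - x).
(* Widths up to [e1] keep all the cutoffs supported in [[c0, d0]], where [u] and [g] are
   integrable. *)
have e1s : e1 <= s - c0 by rewrite ge_min lexx.
have e1x : e1 <= d0 - x by rewrite ge_min lexx orbT.
have e10 : 0 < e1 by rewrite lt_min !subr_gt0 cs.
pose e (n : nat) : R := e1 * n.+1%:R^-1.
have e0 n : 0 < e n by rewrite mulr_gt0 // invr_gt0 ltr0n.
have ele n : e n <= e1.
  by rewrite /e ler_piMr ?(ltW e10) // invf_le1 ?ltr0n // ler1n.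
have ecvg : e n @[n --> \oo] --> 0.
  rewrite -[X in _ --> X](mulr0 e1); apply: cvgMr; exact: cvg_harmonic.
have ha n : c0 <= s - e n by have := ele n; lra.
have hb n : x + e n <= d0 by have := ele n; lra.
have hs := @bump_average_cvg R u c0 d0 s e e0 ha _ ecvg ui ls.
have {}hs := hs ltac:(by move=> n; have := hb n; have := e0 n; lra).
have hx := @bump_average_cvg R u c0 d0 x e e0 _ hb ecvg ui lx.
have {}hx := hx ltac:(by move=> n; have := ha n; have := e0 n; lra).
have sub_cd : `[c0, d0]%classic `<=` `]a, b[%classic.
  by move=> z; rewrite /= !in_itv/= => /andP[? ?]; apply/andP; split; lra.
have out (z : R) : ~ `[c0, d0]%classic z -> (z < c0) \/ (d0 < z).
  rewrite /= in_itv/= => /negP; rewrite negb_and -!ltNge => /orP[]; by [left|right].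
have ident n : (\int[mu]_(z in `[c0, d0]) (u z * bump s (e n) z)%:E -
      \int[mu]_(z in `[c0, d0]) (u z * bump x (e n) z)%:E =
    - \int[mu]_(z in `[c0, d0]) (g z * (ramp s (e n) z - ramp x (e n) z))%:E)%E.
  have sn : a < s - e n by have := ha n; lra.
  have xn : x + e n < b by have := hb n; lra.
  have [tf dE] := test_fun_ramps (e0 n) sn (ltW sx) xn.
  have [_ /(_ _ tf)] := wd; rewrite dE.
  rewrite (@integral_support _ `[c0, d0]) //; last first.
    move=> z /out [h|h].
      have [|_ ->] := @ramp_left _ s (e n) z (e0 n); first by have := ha n; lra.
      by have [|_ ->] := @ramp_left _ x (e n) z (e0 n); [have := ha n; lra|rewrite subrr mulr0].
    have [|_ ->] := @ramp_right _ s (e n) z (e0 n); first by have := hb n; lra.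
    by have [|_ ->] := @ramp_right _ x (e n) z (e0 n); [have := hb n; lra|rewrite subrr mulr0].
  rewrite (@integral_support _ `[c0, d0] (fun z => g z * _)) //; last first.
    move=> z /out [h|h].
      have [|-> _] := @ramp_left _ s (e n) z (e0 n); first by have := ha n; lra.
      by have [|-> _] := @ramp_left _ x (e n) z (e0 n); [have := ha n; lra|rewrite subrr mulr0].
    have [|-> _] := @ramp_right _ s (e n) z (e0 n); first by have := hb n; lra.
    by have [|-> _] := @ramp_right _ x (e n) z (e0 n); [have := hb n; lra|rewrite subrr mulr0].
  move=> <-; rewrite -integralB //; try exact: integrable_bump.
  by apply: eq_integral => z _; rewrite -EFinB -mulrBr.
have mg : measurable_fun `[c0, d0] g by apply/measurable_EFinP; exact: measurable_int gi.
have mramp c n : measurable_fun `[c0, d0] (ramp c (e n)).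
  by apply: measurable_funTS; apply: continuous_measurable_fun; exact: continuous_ramp.
have := @dominated_convergence _ _ R mu `[c0, d0]%classic _
  (fun n z => (g z * (ramp s (e n) z - ramp x (e n) z))%:E)
  (fun z => (g z * \1_(`[s, x]%classic) z)%:E) (fun z => `|(g z)%:E|%E).
case.
- exact: measurable_itv.
- by move=> n; apply/measurable_EFinP; apply: measurable_funM => //; apply: measurable_funB; exact: mramp.
- by apply/measurable_EFinP; apply: measurable_funM.
- exists [set s; x]; split.
  + by apply: measurableU; exact: measurable_set1.
  + apply: countable_lebesgue_measure0; apply: finite_set_countable; exact: finite_set2.
  + move=> z /= hz; apply: contrapT => hz'; apply: hz => _.
    apply: cvg_EFin; first by apply: nearW.
    apply: cvgM; first exact: cvg_cst.
    apply: ramps_cvg => //; [apply/eqP => zs|apply/eqP => zx|exact: ltW]; apply: hz'; [by left|by right].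
- exact: (integrable_abse gi).
- apply: aeW => z n _; rewrite /= lee_fin normrM ler_piMr //.
  have /andP[h1 h2] := step_itv ((z - s + e n) / (2 * e n)).
  have /andP[h3 h4] := step_itv ((z - x + e n) / (2 * e n)).
  by rewrite /ramp ler_norml; apply/andP; split; clear -h1 h2 h3 h4; lra.
move=> _ _ lim.
have limL : (\int[mu]_(z in `[c0, d0]) (u z * bump s (e n) z)%:E -
      \int[mu]_(z in `[c0, d0]) (u z * bump x (e n) z)%:E)%E @[n --> \oo] --> ((u s)%:E - (u x)%:E)%E.
  by apply: cvgeB.
have limR : (- \int[mu]_(z in `[c0, d0]) (g z * (ramp s (e n) z - ramp x (e n) z))%:E)%E @[n --> \oo]
    --> (- \int[mu]_(z in `[c0, d0]) (g z * \1_(`[s, x]%classic) z)%:E)%E.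
  exact: cvgeN.
have E : ((u s)%:E - (u x)%:E = - \int[mu]_(z in `[c0, d0]) (g z * \1_(`[s, x]%classic) z)%:E)%E.
  apply: (cvg_unique _ limL); first exact: ereal_hausdorff.
  by move: limR; rewrite -(funext ident).
have -> : (u x - u s)%:E = (- ((u s)%:E - (u x)%:E))%E by rewrite -EFinB -EFinN opprB.
rewrite E oppeK.
rewrite (@integral_support _ `[s, x]).
- by apply: eq_integral => z zi; rewrite indicE zi mulr1.
- by move=> z; rewrite /= !in_itv/= => /andP[? ?]; apply/andP; split; lra.
- by move=> z zi; rewrite indicE memNset ?mulr0.
Qed.

(** The exceptional points are those that are not Lebesgue points of [u] restricted to [[c0, d0]].
    An identity between almost all pairs of points serves in place of a continuous representative of
    [u]. *)
Lemma weak_deriv_increment : exists2 Z : set R, mu.-negligible Z &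
  forall s x, c0 < s -> s <= x -> x < d0 -> ~ Z s -> ~ Z x ->
  ((u x - u s)%:E = \int[mu]_(z in `[s, x]) (g z)%:E)%E.
Proof.
have loc := integrable_locally_restrict (measurable_itv _) ui.
exists [set x | ~ lebesgue_pt (u \_ `[c0, d0]) x]; first exact: (lebesgue_differentiation loc).
move=> s x cs + xd /contrapT hs /contrapT hx; rewrite le_eqVlt => /predU1P[<-|sx].
  by rewrite subrr set_itv1 integral_set1.
exact: lebesgue_pt_increment.
Qed.

End AbsoluteContinuity.

(** * A Poincare inequality with control on a subset *)

Section Poincare.
Variable R : realType.
Local Notation mu := (@lebesgue_measure R).

(* Optimize [2 |g| <= lambda g^2 + lambda^-1] over [lambda]. *)
Lemma amgm_sqr (A G h : R) : 0 <= A -> 0 <= G -> 0 < h ->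
  (forall k, 0 < k -> 2 * A <= k * G + h / k) -> A ^+ 2 <= h * G.
Proof.
move=> A0 G0 h0 H.
have [->|An] := eqVneq A 0; first by rewrite expr0n mulr_ge0 // ltW.
have Ap : 0 < A by rewrite lt_def An.
have := H (h / A) (divr_gt0 h0 Ap).
rewrite invf_div (_ : h * (A / h) = A); last by rewrite mulrCA divff ?mulr1 // gt_eqF.
rewrite [h / A * G]mulrAC -lerBlDr (_ : 2 * A - A = A); last by ring.
by rewrite ler_pdivlMr // expr2.
Qed.

(** Cauchy-Schwarz, obtained by integrating [2 |g| <= k g^2 + 1/k] over [[a, b]] and optimizing in
    [k] through [amgm_sqr]. *)
Lemma integral_sqr_le (g : R -> R) (a b s x : R) : a < b -> a <= s -> s <= x -> x <= b ->
  mu.-integrable `[a, b] (EFin \o g) -> (\int[mu]_(z in `[a, b]) ((g z) ^+ 2)%:E < +oo)%E ->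
  (fine (\int[mu]_(z in `[s, x]) (g z)%:E)) ^+ 2 <=
    (b - a) * fine (\int[mu]_(z in `[a, b]) ((g z) ^+ 2)%:E).
Proof.
move=> ab as_ sx xb gi Goo.
have mg : measurable_fun `[a, b] g by apply/measurable_EFinP; exact: measurable_int gi.
have sub : `[s, x]%classic `<=` `[a, b]%classic.
  by move=> z; rewrite /= !in_itv/= => /andP[? ?]; apply/andP; split; lra.
have gi' : mu.-integrable `[s, x] (EFin \o g) by apply: integrableS gi.
have Gfin : (\int[mu]_(z in `[a, b]) ((g z) ^+ 2)%:E)%E \is a fin_num.
  by rewrite ge0_fin_numE // integral_ge0 // => z _; rewrite lee_fin sqr_ge0.
have Afin : (\int[mu]_(z in `[a, b]) `|(g z)%:E|)%E \is a fin_num.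
  by rewrite ge0_fin_numE; [case/integrableP : gi|exact: integral_ge0].
pose A := fine (\int[mu]_(z in `[a, b]) `|(g z)%:E|)%E.
have A0 : 0 <= A by apply: fine_ge0; exact: integral_ge0.
have gA : `|fine (\int[mu]_(z in `[s, x]) (g z)%:E)| <= A.
  rewrite -lee_fin -fine_abse; last exact: integrable_fin_num.
  rewrite /A !fineK //; last by rewrite abse_fin_num; exact: integrable_fin_num.
  apply: (le_trans (le_abse_integral _ _ _)) => //; first exact: measurable_int gi'.
  apply: ge0_subset_integral => //.
  by apply: measurableT_comp => //; exact: measurable_int gi.
rewrite -real_normK ?num_real //; apply: (@le_trans _ _ (A ^+ 2)).
  by rewrite lerXn2r ?nnegrE.
apply: amgm_sqr => //; [|lra|].
  by apply: fine_ge0; apply: integral_ge0 => z _; rewrite lee_fin sqr_ge0.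
move=> k k0; rewrite -lee_fin EFinD !EFinM !fineK //.
have mabs : measurable_fun `[a, b] (fun z => `|(g z)%:E|%E).
  by apply: measurableT_comp => //; exact/measurable_EFinP.
have msqr : measurable_fun `[a, b] (fun z => ((g z) ^+ 2)%:E).
  by apply/measurable_EFinP; exact: measurable_funX.
rewrite -ge0_integralZl //.
rewrite (_ : ((b - a)%:E * (k^-1)%:E = \int[mu]_(z in `[a, b]) (k^-1)%:E)%E); last first.
  have muI : mu `[a, b]%classic = (b - a)%:E by rewrite lebesgue_measure_itv /= lte_fin ab.
  transitivity ((k^-1)%:E * mu `[a, b]%classic)%E; first by rewrite muI muleC.
  by rewrite integral_cst.
rewrite -ge0_integralZl //; last 2 first.
- by move=> z _; rewrite lee_fin sqr_ge0.
- by rewrite lee_fin ltW.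
rewrite -ge0_integralD //; last 3 first.
- by move=> z _; rewrite -EFinM lee_fin mulr_ge0 ?sqr_ge0 // ltW.
- by apply: measurable_funeM.
- by move=> z _; rewrite lee_fin invr_ge0 ltW.
apply: ge0_le_integral => //.
- by apply: measurable_funeM.
- by apply: emeasurable_funD => //; apply: measurable_funeM.
move=> z _; rewrite -!EFinM -EFinD lee_fin.
have kk : k * k^-1 = 1 by rewrite divff // gt_eqF.
have ki : 0 < k^-1 by rewrite invr_gt0.
have : 0 <= k^-1 * (k * `|g z| - 1) ^+ 2 by rewrite mulr_ge0 ?sqr_ge0 // ltW.
have -> : k^-1 * (k * `|g z| - 1) ^+ 2 =
  (k * k^-1) * k * `|g z| ^+ 2 - 2 * (k * k^-1) * `|g z| + k^-1 by ring.
by rewrite kk real_normK ?num_real //; lra.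
Qed.

(** For almost all [s] and [x] in the interval, [u(x)^2] is bounded by [2 u(s)^2] plus a multiple of
    the gradient term. Integrating in [x] over the interval and averaging in [s] over [E] alone
    gives the claim. *)
Lemma poincare_subset (a b i0 i1 eta : R) (u g : R -> R) (E : set R) :
  weak_deriv a b u g -> a < i0 -> i0 < i1 -> i1 < b -> 0 < eta ->
  measurable E -> E `<=` `[i0, i1] -> (eta%:E <= mu E)%E ->
  (\int[mu]_(z in `[i0, i1]) ((u z) ^+ 2)%:E < +oo)%E ->
  (\int[mu]_(z in `[i0, i1]) ((g z) ^+ 2)%:E < +oo)%E ->
  (\int[mu]_(z in `[i0, i1]) ((u z) ^+ 2)%:E <=
    (2 * (i1 - i0) / eta)%:E * \int[mu]_(z in E) ((u z) ^+ 2)%:E +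
    (2 * (i1 - i0) ^+ 2)%:E * \int[mu]_(z in `[i0, i1]) ((g z) ^+ 2)%:E)%E.
Proof.
move=> wd ai0 i01 i1b eta0 mE EI Eeta Uoo Goo.
pose c0 := (a + i0) / 2; pose d0 := (i1 + b) / 2.
have ac : a < c0 by rewrite /c0; lra.
have db : d0 < b by rewrite /d0; lra.
have ci : c0 < i0 by rewrite /c0; lra.
have id : i1 < d0 by rewrite /d0; lra.
have [Z nZ hZ] := weak_deriv_increment wd ac db.
have [/(_ i0 i1 ai0 i1b)[ui gi] _] := wd.
have mu_ : measurable_fun `[i0, i1] u by apply/measurable_EFinP; exact: measurable_int ui.
have sqr_meas (f : R -> R) (D : set R) : measurable_fun D f ->
    measurable_fun D (fun z => ((f z) ^+ 2)%:E).
  by move=> mf; apply/measurable_EFinP; exact: measurable_funX.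
have sqr_int0 (f : R -> R) (D : set R) : (0 <= \int[mu]_(z in D) ((f z) ^+ 2)%:E)%E.
  by apply: integral_ge0 => z _; rewrite lee_fin sqr_ge0.
have Ufin : (\int[mu]_(z in `[i0, i1]) ((u z) ^+ 2)%:E)%E \is a fin_num by rewrite ge0_fin_numE.
have Gfin : (\int[mu]_(z in `[i0, i1]) ((g z) ^+ 2)%:E)%E \is a fin_num by rewrite ge0_fin_numE.
have VU : (\int[mu]_(z in E) ((u z) ^+ 2)%:E <= \int[mu]_(z in `[i0, i1]) ((u z) ^+ 2)%:E)%E.
  by apply: ge0_subset_integral => //; [exact: sqr_meas|move=> z _; rewrite lee_fin sqr_ge0].
have Vfin : (\int[mu]_(z in E) ((u z) ^+ 2)%:E)%E \is a fin_num.
  by rewrite ge0_fin_numE //; exact: le_lt_trans Uoo.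
have muI : mu `[i0, i1]%classic = (i1 - i0)%:E by rewrite lebesgue_measure_itv /= lte_fin i01.
have mEI : (mu E <= (i1 - i0)%:E)%E by rewrite -muI; apply: le_measure; rewrite ?inE.
have mEfin : mu E \is a fin_num by rewrite ge0_fin_numE // (le_lt_trans mEI) // ltry.
pose h := i1 - i0; pose G := fine (\int[mu]_(z in `[i0, i1]) ((g z) ^+ 2)%:E)%E.
pose U := fine (\int[mu]_(z in `[i0, i1]) ((u z) ^+ 2)%:E)%E.
pose V := fine (\int[mu]_(z in E) ((u z) ^+ 2)%:E)%E.
have h0 : 0 < h by rewrite subr_gt0.
have G0 : 0 <= G by exact: fine_ge0.
have V0 : 0 <= V by exact: fine_ge0.
have pt s x : i0 <= s <= i1 -> i0 <= x <= i1 -> ~ Z s -> ~ Z x ->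
    u x ^+ 2 <= 2 * u s ^+ 2 + 2 * (h * G).
  move=> /andP[s0 s1] /andP[x0 x1] Zs Zx.
  (* The square of [u x - 2 * u s] is exactly what separates [u x ^+ 2] from
     [2 * u s ^+ 2 + 2 * (u x - u s) ^+ 2]. *)
  suff : (u x - u s) ^+ 2 <= h * G by have := sqr_ge0 (u x - 2 * u s); clear; lra.
  have [sx|xs] := leP s x.
    have cs := lt_le_trans ci s0.
    have xd := le_lt_trans x1 id.
    have := integral_sqr_le i01 s0 sx x1 gi Goo.
    by rewrite -(hZ s x cs sx xd Zs Zx).
  have cx := lt_le_trans ci x0.
  have sd := le_lt_trans s1 id.
  have := integral_sqr_le i01 x0 (ltW xs) s1 gi Goo.
  by rewrite -(hZ x s cx (ltW xs) sd Zx Zs) /= -sqrrN opprB.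
have aes s : i0 <= s <= i1 -> ~ Z s -> U <= 2 * h * u s ^+ 2 + 2 * h ^+ 2 * G.
  move=> hs Zs; rewrite -lee_fin /U fineK //.
  have -> : ((2 * h * u s ^+ 2 + 2 * h ^+ 2 * G)%:E =
      \int[mu]_(x in `[i0, i1]) (2 * u s ^+ 2 + 2 * (h * G))%:E)%E.
    by rewrite integral_cst // [X in (_ * X)%E]muI -EFinM; congr (_%:E); rewrite -/h; ring.
  apply: ae_ge0_le_integral => //.
  - by move=> z _; rewrite lee_fin sqr_ge0.
  - exact: sqr_meas.
  - by move=> z _; rewrite lee_fin; have := sqr_ge0 (u s); have := mulr_ge0 (ltW h0) G0; lra.
  apply: negligibleS nZ => x /= hx; apply: contrapT => Zx; apply: hx.
  by rewrite in_itv/= => xi; rewrite lee_fin; exact: pt.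
have cst (k : R) : (\int[mu]_(s in E) k%:E = (k * fine (mu E))%:E)%E.
  by rewrite integral_cst // EFinM fineK.
(* Integration of [aes] over [s] in [E], whose left side is constant in [s]. *)
have main : U * fine (mu E) <= 2 * h * V + 2 * h ^+ 2 * G * fine (mu E).
  have k10 : 0 <= 2 * h by rewrite mulr_ge0 // ltW.
  have k20 : 0 <= 2 * h ^+ 2 * G by rewrite !mulr_ge0 // ltW.
  move: (2 * h) (2 * h ^+ 2 * G) k10 k20 aes => k1 k2 k10 k20 aes.
  have muE : measurable_fun E u by apply: measurable_funS mu_.
  have VE : (V%:E = \int[mu]_(z in E) ((u z) ^+ 2)%:E)%E by rewrite /V fineK.
  have sE : measurable_fun E (fun z => ((u z) ^+ 2)%:E) by exact: sqr_meas.
  rewrite -lee_fin EFinD -!cst EFinM VE -ge0_integralZl //; last first.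
    by move=> z _; rewrite lee_fin sqr_ge0.
  rewrite -ge0_integralD //; last 2 first.
  - by move=> z _; rewrite -EFinM lee_fin mulr_ge0 ?sqr_ge0.
  - exact: measurable_funeM.
  apply: ae_ge0_le_integral => //.
  - by move=> z _; rewrite lee_fin; exact: fine_ge0.
  - by move=> z _; rewrite -EFinM -EFinD lee_fin addr_ge0 // mulr_ge0 ?sqr_ge0.
  - by apply: emeasurable_funD => //; apply: measurable_funeM; exact: sqr_meas.
  apply: negligibleS nZ => s /= hs; apply: contrapT => Zs; apply: hs => Es.
  rewrite -EFinM -EFinD lee_fin; apply: aes => //.
  by have := EI s Es; rewrite /= in_itv/=.
have m_eta : eta <= fine (mu E) by rewrite -lee_fin fineK.
rewrite -(fineK Ufin) -(fineK Vfin) -(fineK Gfin) -!EFinM -EFinD lee_fin -/U -/V -/G -/h.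
have m0 : 0 < fine (mu E) by exact: lt_le_trans m_eta.
have {}main : U <= 2 * h * V / fine (mu E) + 2 * h ^+ 2 * G.
  by rewrite -(ler_pM2r m0) mulrDl divfK // gt_eqF.
apply: (le_trans main); rewrite lerD2r -[leRHS]mulrAC.
apply: ler_wpM2l; first by rewrite !mulr_ge0 // ltW.
by rewrite lef_pV2 ?posrE.
Qed.

End Poincare.

(** * Assembling the cells into the full inequality *)

Section Assembly.
Variable R : realType.
Local Notation mu := (@lebesgue_measure R).

Import HBNNSimple.

(* No measurability is needed since the integral of a nonnegative function is a supremum over simple functions. *)
Lemma ge0_le_integral_nonmeas (D : set R) (f g : R -> \bar R) :
  (forall x, D x -> 0 <= f x)%E -> (forall x, D x -> f x <= g x)%E ->
  (\int[mu]_(x in D) f x <= \int[mu]_(x in D) g x)%E.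
Proof.
move=> f0 fg; have g0 x : D x -> (0 <= g x)%E by move=> Dx; apply: le_trans (fg x Dx); exact: f0.
rewrite !ge0_integralE //; apply: ge_ereal_sup => _ [h hf <-].
apply: ereal_sup_ubound; exists h => // x; apply: (le_trans (hf x)).
by rewrite !patchE; case: ifPn => // /[1!inE]; exact: fg.
Qed.

(** Local integrability gives measurability on compact intervals exhausting the open one; adding the
    two endpoints does no harm. *)
Lemma measurable_weak_deriv (a b : R) (u g : R -> R) : weak_deriv a b u g ->
  measurable_fun `[a, b] u /\ measurable_fun `[a, b] g.
Proof.
move=> [ugi _].
have cover_ : `]a, b[%classic = \bigcup_n `[a + n.+1%:R^-1, b - n.+1%:R^-1]%classic.
  apply/seteqP; split => [z|z [n _]]; rewrite /= !in_itv/=.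
    move=> /andP[az zb].
    have d0 : 0 < Num.min (z - a) (b - z) by rewrite lt_min !subr_gt0 az.
    have [n hn] := ltr_add_invr d0.
    move: hn; rewrite add0r lt_min => /andP[h1 h2].
    exists n => //; rewrite /= in_itv/=; apply/andP.
    by split; [rewrite -lerBrDl|rewrite lerBrDr addrC -lerBrDr]; exact: ltW.
  have : 0 < n.+1%:R^-1 :> R by rewrite invr_gt0.
  by move: n.+1%:R^-1 => t h /andP[? ?]; apply/andP; split; lra.
have h (f : R -> R) : (forall c d, a < c -> d < b -> mu.-integrable `[c, d] (EFin \o f)) ->
    measurable_fun `[a, b] f.
  move=> fi; apply: (@measurable_fun_itv_cc _ _ _ false true); rewrite cover_.
  apply/measurable_fun_bigcup => // n; apply/measurable_EFinP.
  have n0 : 0 < n.+1%:R^-1 :> R by rewrite invr_gt0.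
  have : mu.-integrable `[a + n.+1%:R^-1, b - n.+1%:R^-1] (EFin \o f).
    by move: n.+1%:R^-1 n0 => t t0; apply: fi; lra.
  exact: measurable_int.
by split; apply: h => c d ac db; have [] := ugi c d ac db.
Qed.

(** [kappa / (1 + 2 * kappa)] is at most 1/3 and at most [kappa]. The first bound serves the term on
    the good set, where no power of [kappa] is available; the second lets the gradient term be paid
    from the fraction [kappa]. *)
Lemma ckappa_sqr_le (kappa : R) : 0 <= kappa <= 1 ->
  ckappa kappa ^+ 2 <= (1 / 6300) ^+ 2 /\ ckappa kappa ^+ 2 <= kappa / 1000.
Proof.
move=> /andP[k0 k1].
have d0 : 0 < 1 + 2 * kappa by lra.
pose t := kappa / (1 + 2 * kappa).
have t0 : 0 <= t by rewrite divr_ge0 // ltW.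
have t3 : t <= 3^-1 by rewrite ler_pdivrMr //; lra.
have tk : t <= kappa by rewrite ler_pdivrMr //; nra.
have e0 : 0 <= 47 / 10 ^+ 5 :> R by rewrite divr_ge0 // exprn_ge0.
have e1 : 47 / 10 ^+ 5 <= 1 / 2100 :> R.
  have -> : 10 ^+ 5 = 100 * (10 * 100) :> R by ring.
  by rewrite ler_pdivrMr; lra.
have -> : ckappa kappa = (47 / 10 ^+ 5) * t by rewrite /ckappa mulrA.
set e := 47 / 10 ^+ 5 in e0 e1 *.
have et0 : 0 <= e * t by rewrite mulr_ge0.
have h1 : e * t <= 1 / 6300.
  by apply: le_trans (ler_pM e0 t0 e1 t3) _; clear; lra.
have h2 : e * t <= kappa / 1000.
  by apply: le_trans (ler_pM e0 t0 e1 tk) _; clear -k0; lra.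
have h3 : e * t <= 1 by clear -h1; lra.
have d1 : 0 <= 1 / 6300 :> R by apply: divr_ge0; [exact: ler01|exact: ler0n].
split; first by move: (1 / 6300) h1 d1 => d h1 d1; rewrite ler_sqr ?nnegrE.
by apply: le_trans h2; rewrite expr2 ler_piMr.
Qed.

Definition rhs_weight (K : R) (w : R -> R) (r : R) : R := K / r ^+ 2 * w r * r.

Lemma rhs_weight_ge0 K w r : 0 <= K -> 0 <= w r -> 0 <= r -> 0 <= rhs_weight K w r.
Proof. by move=> K0 w0 r0; rewrite !mulr_ge0 // invr_ge0 sqr_ge0. Qed.

Lemma measurable_rhs_weight (D : set R) K w : measurable D -> measurable_fun D w ->
  (forall r, D r -> 0 < r) -> measurable_fun D (EFin \o rhs_weight K w).
Proof.
move=> mD mw D0; apply/measurable_EFinP.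
apply: measurable_funM; last exact: measurable_funTS.
apply: measurable_funM => //.
apply: measurable_funM => //.
have : measurable_fun D (fun r : R => r `^ (-2)).
  by apply: measurable_funTS; exact: measurable_powR.
apply: eq_measurable_fun => r; rewrite inE => Dr.
have r0 := D0 r Dr.
by rewrite powRN powR_mulrn // ltW.
Qed.

(** The cell length [q / 2] is at most [i / 6], so [r] varies by a factor 7/6 at most. The constants
    meet because [80 * 7/6 * 640^2 <= 6300^2], with less than four percent to spare. *)
Lemma good_set_coeff_le (k a q i r : R) : 0 <= k -> 0 <= a -> k <= (1 / 6300) ^+ 2 * a ->
  0 < i -> 3 * q <= i -> r <= i + q / 2 -> k * 80 * r <= (a / 640 ^+ 2) * i.
Proof.
move=> k0 a0 ka i0 qi riq; have ri : r <= 7 / 6 * i by lra.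
have k80 : 0 <= k * 80 by rewrite mulr_ge0.
apply: (le_trans (ler_wpM2l k80 ri)); rewrite mulrA; apply: ler_wpM2r; first exact: ltW.
by lra.
Qed.

(** The Poincare constant [q^2 / 2] is absorbed by the weight, as [q <= i]; here, unlike on the good
    set, the slack is large. *)
Lemma gradient_coeff_le (c a q i kappa : R) : 0 <= c -> 0 <= a <= 4 -> c <= kappa / 1000 ->
  0 < q -> 3 * q <= i -> c * a * (q ^+ 2 / 2) <= kappa * i * i.
Proof.
move=> c0 /andP[a0 a4] ck q0 qi; have k0 : 0 <= kappa by lra.
rewrite -[leRHS]mulrA; apply: ler_pM; [exact: mulr_ge0| |have := ler_pM c0 a0 ck a4; lra|].
  by rewrite divr_ge0 ?sqr_ge0.
have q2 : q ^+ 2 <= i * i by rewrite expr2; apply: ler_pM; lra.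
have : 0 <= q ^+ 2 by exact: sqr_ge0.
by lra.
Qed.

(** * The inequality on one cell and on consecutive cells *)

Section Cells.
Variables (alpha q L kappa : R) (N : nat) (y : 'I_(N - 2) -> R * R).
Variables (u1 u2 du1 du2 : R -> R).
Hypotheses (q_gt0 : 0 < q) (k01 : 0 <= kappa <= 1) (A_gt0 : 0 < alphaN alpha N).
Hypotheses (W1 : W12r q L u1 du1) (W2 : W12r q L u2 du2).

Let A := alphaN alpha N.
(** For [u = u1 + i u2]: [w] is [|u|^2], [D] is [|u'|^2], [K / r^2] is the coefficient of [w] wanted
    on the right, and [S] is the lower bound for [rho] at good radii. *)
Let K := ckappa kappa ^+ 2 * A ^+ 2.
Let S := (A / 640) ^+ 2.
Let w (r : R) : R := u1 r ^+ 2 + u2 r ^+ 2.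
Let D (r : R) : R := du1 r ^+ 2 + du2 r ^+ 2.

Let K0 : 0 <= K. Proof. by rewrite mulr_ge0 ?sqr_ge0. Qed.
Let S0 : 0 <= S. Proof. exact: sqr_ge0. Qed.
Let w0 r : 0 <= w r. Proof. by rewrite addr_ge0 ?sqr_ge0. Qed.
Let D0 r : 0 <= D r. Proof. by rewrite addr_ge0 ?sqr_ge0. Qed.

Let mw : measurable_fun `[q, L] w.
Proof.
have [m1 _] := measurable_weak_deriv (proj1 W1); have [m2 _] := measurable_weak_deriv (proj1 W2).
by apply: measurable_funD; exact: measurable_funX.
Qed.

Let mD : measurable_fun `[q, L] D.
Proof.
have [_ m1] := measurable_weak_deriv (proj1 W1); have [_ m2] := measurable_weak_deriv (proj1 W2).
by apply: measurable_funD; exact: measurable_funX.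
Qed.

(** Cell length [q / 2] and good measure [q / 80] give the constants 80 and [q^2 / 2]. The weight
    [r] is at least [q], so the weighted integrability of [W12r] yields the unweighted one. *)
Lemma cell_poincare (u du : R -> R) (i0 i1 : R) (E : set R) : W12r q L u du ->
  3 * q <= i0 -> i1 = i0 + q / 2 -> i1 < L -> measurable E -> E `<=` `[i0, i1] ->
  ((q / 80)%:E <= mu E)%E ->
  (\int[mu]_(r in `[i0, i1]) (u r ^+ 2)%:E <=
    80%:E * \int[mu]_(r in E) (u r ^+ 2)%:E +
    (q ^+ 2 / 2)%:E * \int[mu]_(r in `[i0, i1]) (du r ^+ 2)%:E)%E.
Proof.
move=> [wd [Uoo Goo]] hi i1E iL mE EI Eq; have q0 := q_gt0.
have [mu_ mg] := measurable_weak_deriv wd.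
have sub : `[i0, i1]%classic `<=` `[q, L]%classic.
  by move=> r; rewrite /= !in_itv/= => /andP[? ?]; apply/andP; split; lra.
have fin (f : R -> R) : measurable_fun `[q, L] f ->
    (\int[mu]_(r in `[q, L]) (f r ^+ 2 * r)%:E < +oo)%E ->
    (\int[mu]_(r in `[i0, i1]) (f r ^+ 2)%:E < +oo)%E.
  move=> mf foo; apply: (@le_lt_trans _ _ ((q^-1)%:E * \int[mu]_(r in `[q, L]) (f r ^+ 2 * r)%:E)%E).
    have m2 : measurable_fun `[q, L] (fun r => (f r ^+ 2 * r)%:E).
      by apply/measurable_EFinP; apply: measurable_funM => //; exact: measurable_funX.
    rewrite -ge0_integralZl //; last 2 first.
    - move=> r; rewrite /= in_itv/= => /andP[qr _]; rewrite lee_fin mulr_ge0 ?sqr_ge0 //.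
      exact: le_trans (ltW q0) qr.
    - by rewrite lee_fin invr_ge0 ltW.
    apply: (@le_trans _ _ (\int[mu]_(r in `[i0, i1]) ((q^-1)%:E * (f r ^+ 2 * r)%:E))%E).
      apply: ge0_le_integral_nonmeas => r; first by rewrite lee_fin sqr_ge0.
      rewrite /= in_itv/= => /andP[r0 _]; rewrite -EFinM lee_fin mulrC -mulrA ler_peMr ?sqr_ge0 //.
      by rewrite ler_pdivlMr //; lra.
    apply: ge0_subset_integral => //; first exact: measurable_funeM.
    move=> r; rewrite /= in_itv/= => /andP[r0 _]; rewrite -EFinM lee_fin.
    apply: mulr_ge0; first by rewrite invr_ge0 ltW.
    by apply: mulr_ge0; [exact: sqr_ge0|exact: le_trans (ltW q0) r0].
  by apply: lte_mul_pinfty => //; rewrite lee_fin invr_ge0 ltW.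
have qi : q < i0 by lra.
have ii : i0 < i1 by lra.
have eta : 0 < q / 80 by rewrite divr_gt0.
have := poincare_subset wd qi ii iL eta mE EI Eq (fin u mu_ Uoo) (fin du mg Goo).
have -> : 2 * (i1 - i0) / (q / 80) = 80.
  by rewrite i1E (addrC i0) addrK; field; rewrite gt_eqF.
by have -> : 2 * (i1 - i0) ^+ 2 = q ^+ 2 / 2 by rewrite i1E (addrC i0) addrK; field.
Qed.

(** The Poincare inequality is unweighted, so [K / r] is first frozen at its largest value [K / i0];
    the weights of the two resulting terms are then restored, at the cost of the bounded ratio of
    radii within a cell. Cells are half-open so that they tile. *)
Lemma cell_inequality (i0 i1 : R) : 3 * q <= i0 -> i1 = i0 + q / 2 -> i1 < L ->
  exists E : set R, [/\ measurable E, E `<=` `[i0, i1[, forall r, E r -> S <= rho alpha q y r &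
    (\int[mu]_(r in `[i0, i1[) (rhs_weight K w r)%:E <=
     \int[mu]_(r in `[i0, i1[) (kappa * D r * r)%:E + \int[mu]_(r in E) (rhs_weight S w r)%:E)%E].
Proof.
move=> hi i1E iL; have q0 := q_gt0.
have [E [mE EI Eq Erho]] := @rho_good_cell R alpha q i0 i1 N y q0 hi i1E A_gt0.
have sub : `[i0, i1]%classic `<=` `[q, L]%classic.
  by move=> r; rewrite /= !in_itv/= => /andP[? ?]; apply/andP; split; lra.
have posI r : `[i0, i1]%classic r -> 0 < r.
  by rewrite /= in_itv/= => /andP[? _]; lra.
have mwI : measurable_fun `[i0, i1] w by apply: measurable_funS mw.
have mwE : measurable_fun E w by apply: measurable_funS mwI.
have mDI : measurable_fun `[i0, i1] D by apply: measurable_funS mD.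
have mKw := @measurable_rhs_weight _ K w (measurable_itv _) mwI posI.
have mSw := @measurable_rhs_weight _ S w mE mwE (fun r Er => posI r (EI r Er)).
have mkD : measurable_fun `[i0, i1] (fun r => (kappa * D r * r)%:E).
  by apply/measurable_EFinP; apply: measurable_funM => //; exact: measurable_funM.
have k0 : 0 <= kappa by have /andP[] := k01.
have [cc ck] := ckappa_sqr_le k01.
have A2 : A <= 2 := alphaN_le2 alpha N.
have A0 : 0 < A := A_gt0.
have A20 : 0 <= A ^+ 2 by exact: sqr_ge0.
have AA : 0 <= A ^+ 2 <= 4.
  by rewrite A20 (_ : 4 = 2 ^+ 2); [rewrite lerXn2r // nnegrE // ltW|ring].
have i00 : 0 < i0 by apply: lt_le_trans hi; rewrite mulr_gt0.
(* The right endpoint belongs to the next cell. *)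
exists (E `\ i1); split.
- exact: measurableD.
- move=> r [Er ri]; have := EI r Er; rewrite /= !in_itv/= => /andP[-> h] /=.
  by rewrite lt_def h andbT eq_sym; apply/eqP.
- by move=> r [Er _]; exact: Erho.
rewrite integral_setD1; [|exact: measurableD|by apply: measurable_funS mSw => // r []].
rewrite !integral_itv_bndo_bndc; last 2 first.
- by apply: measurable_funS mkD => // r; rewrite /= !in_itv/= => /andP[? ?]; apply/andP; split => //; exact: ltW.
- by apply: measurable_funS mKw => // r; rewrite /= !in_itv/= => /andP[? ?]; apply/andP; split => //; exact: ltW.
have sq_meas (f : R -> R) (B : set R) : measurable_fun B f -> measurable_fun B (fun r => (f r ^+ 2)%:E).
  by move=> mf; apply/measurable_EFinP; exact: measurable_funX.
have [m1 n1] := measurable_weak_deriv (proj1 W1); have [m2 n2] := measurable_weak_deriv (proj1 W2).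
have onI (f : R -> R) : measurable_fun `[q, L] f -> measurable_fun `[i0, i1] f by move=> mf; apply: measurable_funS mf.
have onE (f : R -> R) : measurable_fun `[q, L] f -> measurable_fun E f.
  by move=> mf; apply: measurable_funS (onI f mf).
have split_sum (B : set R) (f1 f2 : R -> R) : measurable B -> measurable_fun B f1 -> measurable_fun B f2 ->
    (\int[mu]_(r in B) (f1 r ^+ 2 + f2 r ^+ 2)%:E =
     \int[mu]_(r in B) (f1 r ^+ 2)%:E + \int[mu]_(r in B) (f2 r ^+ 2)%:E)%E.
  move=> mB mf1 mf2; under eq_integral do rewrite EFinD.
  by rewrite ge0_integralD //; [move=> r _; rewrite lee_fin sqr_ge0|exact: sq_meas|
    move=> r _; rewrite lee_fin sqr_ge0|exact: sq_meas].
have P : (\int[mu]_(r in `[i0, i1]) (w r)%:E <= 80%:E * \int[mu]_(r in E) (w r)%:E +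
    (q ^+ 2 / 2)%:E * \int[mu]_(r in `[i0, i1]) (D r)%:E)%E.
  have I0 (f : R -> R) (B : set R) : (0 <= \int[mu]_(r in B) (f r ^+ 2)%:E)%E.
    by apply: integral_ge0 => r _; rewrite lee_fin sqr_ge0.
  have P1 := cell_poincare W1 hi i1E iL mE EI Eq.
  have P2 := cell_poincare W2 hi i1E iL mE EI Eq.
  have distr (k : R) (f1 f2 : R -> R) (B : set R) :
      (k%:E * (\int[mu]_(r in B) (f1 r ^+ 2)%:E + \int[mu]_(r in B) (f2 r ^+ 2)%:E) =
       k%:E * (\int[mu]_(r in B) (f1 r ^+ 2)%:E) + k%:E * (\int[mu]_(r in B) (f2 r ^+ 2)%:E))%E.
    exact: ge0_muleDr.
  rewrite /w /D !split_sum //; try exact: onI; try exact: onE.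
  rewrite !distr.
  rewrite [in leRHS]addeACA.
  exact: leeD P1 P2.
have Ki0 : 0 <= K / i0 by rewrite divr_ge0 // ltW.
apply: (@le_trans _ _ ((K / i0)%:E * \int[mu]_(r in `[i0, i1]) (w r)%:E)%E).
  rewrite -ge0_integralZl //; first last.
  - by move=> r _; rewrite lee_fin.
  - exact/measurable_EFinP.
  apply: ge0_le_integral_nonmeas => r ri.
    by rewrite lee_fin rhs_weight_ge0 // ltW // posI.
  rewrite -EFinM lee_fin /rhs_weight mulrAC; apply: ler_wpM2r => //.
  have r0 := posI r ri; move: ri; rewrite /= in_itv/= => /andP[ri _].
  rewrite -mulrA; apply: ler_wpM2l => //.
  by rewrite expr2 invfM -mulrA mulVf ?gt_eqF // mulr1 lef_pV2 ?posrE.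
apply: (le_trans (lee_wpmul2l _ P)); first by rewrite lee_fin.
rewrite ge0_muleDr; last 2 first.
- by rewrite mule_ge0 ?lee_fin // integral_ge0 // => r _; rewrite lee_fin.
- rewrite mule_ge0 ?lee_fin ?divr_ge0 ?sqr_ge0 // integral_ge0 // => r _; rewrite lee_fin //.
rewrite addeC !muleA -!EFinM; apply: leeD.
- rewrite -ge0_integralZl //; first last.
  + by rewrite lee_fin mulr_ge0.
  + by move=> r _; rewrite lee_fin.
  + exact/measurable_EFinP.
  apply: ge0_le_integral_nonmeas => r Er.
    by rewrite -EFinM lee_fin mulr_ge0 // mulr_ge0.
  have r0 := posI r (EI r Er); have := EI r Er; rewrite /= in_itv/= => /andP[_ ri].
  rewrite -EFinM lee_fin /rhs_weight [leRHS]mulrAC; apply: ler_wpM2r => //.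
  have -> : S / r ^+ 2 * r = S / r by field; rewrite gt_eqF.
  rewrite ler_pdivlMr //.
  have -> : K / i0 * 80 * r = K * 80 * r / i0 by ring.
  rewrite ler_pdivrMr //.
  have -> : S = A ^+ 2 / 640 ^+ 2 by rewrite /S expr_div_n.
  apply: (@good_set_coeff_le _ _ q) => //; last by rewrite -i1E.
  exact: ler_wpM2r.
rewrite -ge0_integralZl //; first last.
- by rewrite lee_fin mulr_ge0 // divr_ge0 ?sqr_ge0.
- by move=> r _; rewrite lee_fin.
- exact/measurable_EFinP.
apply: ge0_le_integral_nonmeas => r ri.
  by rewrite -EFinM lee_fin mulr_ge0 // mulr_ge0 // divr_ge0 ?sqr_ge0.
rewrite -EFinM lee_fin [leRHS]mulrAC; apply: ler_wpM2r => //.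
move: ri; rewrite /= in_itv/= => /andP[ri _].
apply: (@le_trans _ _ (kappa * i0)); last by apply: ler_wpM2l.
rewrite mulrAC ler_pdivrMr //.
by apply: gradient_coeff_le => //; exact: sqr_ge0.
Qed.

Lemma cells_inequality (n : nat) : 3 * q + n%:R * (q / 2) < L ->
  exists E : set R, [/\ measurable E, E `<=` `[3 * q, 3 * q + n%:R * (q / 2)[,
    forall r : R, E r -> S <= rho alpha q y r &
    (\int[mu]_(r in `[(3 * q)%R, (3 * q + n%:R * (q / 2))%R[) (rhs_weight K w r)%:E <=
     \int[mu]_(r in `[(3 * q)%R, (3 * q + n%:R * (q / 2))%R[) (kappa * D r * r)%:E +
     \int[mu]_(r in E) (rhs_weight S w r)%:E)%E].
Proof.
have q0 := q_gt0; have k0 : 0 <= kappa by have /andP[] := k01.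
elim: n => [|n IH] hL.
  rewrite mul0r addr0; exists set0; split => //.
  by rewrite set_itvco0 // !integral_set0 adde0.
have E1 : 3 * q + n.+1%:R * (q / 2) = 3 * q + n%:R * (q / 2) + q / 2.
  by rewrite -natr1; ring.
rewrite E1 in hL *.
have nn : 0 <= n%:R * (q / 2) by rewrite mulr_ge0 // divr_ge0 // ltW.
set i0 := 3 * q + n%:R * (q / 2) in IH hL *.
have i0q : 3 * q <= i0 by rewrite /i0; lra.
have [|E [mE EI Er Ei]] := IH; first by lra.
have [E' [mE' EI' Er' Ei']] := cell_inequality i0q erefl hL.
have sub : `[3 * q, i0 + q / 2[%classic `<=` `[q, L]%classic.
  by move=> r; rewrite /= !in_itv/= => /andP[? ?]; apply/andP; split; lra.
have posI r : `[3 * q, i0 + q / 2[%classic r -> 0 < r.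
  by rewrite /= in_itv/= => /andP[? _]; lra.
have U : `[3 * q, i0 + q / 2[%classic = `[3 * q, i0[%classic `|` `[i0, i0 + q / 2[%classic.
  apply/seteqP; split => r /=; rewrite !in_itv/=.
    move=> /andP[h1 h2]; have [h|h] := ltP r i0; [left|right]; first by rewrite h1.
    by [].
  by move=> [|] /andP[? ?]; apply/andP; split; lra.
have mwI : measurable_fun `[3 * q, i0 + q / 2[ w by apply: measurable_funS mw.
have mDI : measurable_fun `[3 * q, i0 + q / 2[ D by apply: measurable_funS mD.
have disj (B B' : set R) : B `<=` `[3 * q, i0[%classic -> B' `<=` `[i0, i0 + q / 2[%classic ->
    [disjoint B & B'].
  move=> hB hB'; apply/disj_setPS => r [Br B'r].
  by have := hB r Br; have := hB' r B'r; rewrite /= !in_itv/= => /andP[? ?] /andP[? ?]; lra.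
have subE : E `|` E' `<=` `[3 * q, i0 + q / 2[%classic.
  by rewrite U; apply: setUSS.
exists (E `|` E'); split => //; first exact: measurableU.
  by move=> r [|]; [exact: Er|exact: Er'].
rewrite U !ge0_integral_setU //; try (by apply: disj).
- by rewrite addeACA; exact: leeD.
- apply: measurable_rhs_weight; [exact: measurableU|exact: measurable_funS mwI|].
  by move=> r /subE; exact: posI.
- by move=> r /subE /posI r0; rewrite lee_fin rhs_weight_ge0 // ltW.
- rewrite -U; apply/measurable_EFinP; apply: measurable_funM => //; exact: measurable_funM.
- by move=> r; rewrite -U => /posI r0; rewrite lee_fin !mulr_ge0 // ltW.
- by rewrite -U; apply: measurable_rhs_weight.
- by move=> r; rewrite -U => /posI r0; rewrite lee_fin rhs_weight_ge0 // ltW.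
Qed.

Lemma rhs_le_lhs_extended : q <= L / 6 ->
  (rhs alpha q L kappa (ckappa kappa) N u1 u2 du1 du2 <= lhs alpha q L y u1 u2 du1 du2)%E.
Proof.
move=> qL; have q0 := q_gt0; have /andP[k0 k1] := k01.
have L6 : 0 <= (L - 6 * q) / (q / 2) by rewrite divr_ge0 //; lra.
(* One cell more than fit into [[3 * q, L - 3 * q]]: this interval is covered, and the overshoot of
   at most [q / 2] stays to the left of [L]. *)
pose m := (Num.trunc ((L - 6 * q) / (q / 2))).+1.
have /andP[m1 m2] := truncn_itv L6.
have h2 : 0 < q / 2 by rewrite divr_gt0.
have mlo : L - 6 * q < m%:R * (q / 2) by rewrite -ltr_pdivrMr.
have mhi : m%:R * (q / 2) <= L - 6 * q + q / 2.
  by rewrite /m -natr1 mulrDl mul1r lerD2r -ler_pdivlMr.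
have [|E [mE EI Er Ei]] := @cells_inequality m; first by lra.
set V := `[3 * q, 3 * q + m%:R * (q / 2)[%classic in EI Ei.
have VI : V `<=` `[q, L]%classic.
  by move=> r; rewrite /V /= !in_itv/= => /andP[? ?]; apply/andP; split; lra.
have mV : measurable V by exact: measurable_itv.
have EV : E `<=` `[q, L]%classic by exact: subset_trans VI.
have posI r : `[q, L]%classic r -> 0 < r by rewrite /= in_itv/= => /andP[? _]; lra.
have KE : ckappa kappa ^+ 2 * alphaN alpha N ^+ 2 = K by [].
have restr (B : set R) (f : R -> R) : B `<=` `[q, L]%classic ->
    (\int[mu]_(r in `[q, L]) (\1_B r * f r)%:E = \int[mu]_(r in B) (f r)%:E)%E.
  move=> Bq; rewrite (@integral_support _ _ B) //.
    by apply: eq_integral => r rB; rewrite indicE rB mul1r.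
  by move=> r nB; rewrite indicE memNset ?mul0r.
have mI (B : set R) (f : R -> R) : measurable B -> measurable_fun `[q, L] f ->
    measurable_fun `[q, L] (fun r => (\1_B r * f r)%:E).
  by move=> mB mf; apply/measurable_EFinP; apply: measurable_funM => //; exact: measurable_indic.
have mKw : measurable_fun `[q, L] (rhs_weight K w).
  by apply/measurable_EFinP; exact: measurable_rhs_weight.
have mSw : measurable_fun `[q, L] (rhs_weight S w).
  by apply/measurable_EFinP; exact: measurable_rhs_weight.
have mcD c : measurable_fun `[q, L] (fun r => c * D r * r).
  by apply: measurable_funM => //; exact: measurable_funM.
have ind01 (B : set R) r : 0 <= \1_B r :> R by rewrite indicE ler0n.
have k10 : 0 <= 1 - kappa by lra.
apply: (@le_trans _ _ (\int[mu]_(r in `[q, L]) (((1 - kappa) * D r * r)%:E + (\1_V r * rhs_weight K w r)%:E))%E).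
  apply: ge0_le_integral_nonmeas => r rI; have r0 := posI r rI.
    rewrite lee_fin; apply: mulr_ge0; last exact: ltW.
    apply: addr_ge0; first by apply: mulr_ge0 => //; exact: D0.
    apply: mulr_ge0; last exact: w0.
    by apply: mulr_ge0 => //; apply: divr_ge0; [exact: K0|exact: sqr_ge0].
  rewrite -EFinD lee_fin KE mulrDl lerD2l /rhs_weight -/(w r).
  have -> : K / r ^+ 2 * \1_(`[3 * q, L - 3 * q]%classic) r * w r * r =
     \1_(`[3 * q, L - 3 * q]%classic) r * (K / r ^+ 2 * w r * r) by ring.
  apply: ler_wpM2r; first exact: (rhs_weight_ge0 K0 (w0 r) (ltW r0)).
  rewrite !indicE ler_nat; case: (boolP (r \in `[3 * q, L - 3 * q]%classic)) => // h.
  rewrite mem_set //; move: h; rewrite inE /V /= !in_itv/= => /andP[? ?].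
  by apply/andP; split; lra.
rewrite ge0_integralD //; first last.
- exact: mI.
- by move=> r /posI r0; rewrite lee_fin mulr_ge0 // rhs_weight_ge0 // ltW.
- by apply/measurable_EFinP; exact: mcD.
- by move=> r /posI r0; rewrite lee_fin !mulr_ge0 // ltW.
rewrite restr //; apply: (le_trans (leeD2l _ Ei)).
(* The share [kappa] of the gradient, spent only on the cells, is enlarged to all of [[q, L]], where
   it completes [1 - kappa] to the full gradient term. *)
apply: (@le_trans _ _ (\int[mu]_(r in `[q, L]) (((1 - kappa) * D r * r)%:E +
  ((kappa * D r * r)%:E + (\1_E r * rhs_weight S w r)%:E)))%E).
  rewrite ge0_integralD //; first last.
  - by apply: emeasurable_funD; [apply/measurable_EFinP; exact: mcD|exact: mI].
  - move=> r /posI r0; rewrite -EFinD lee_fin addr_ge0 //; first by rewrite !mulr_ge0 // ltW.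
    by rewrite mulr_ge0 // rhs_weight_ge0 // ltW.
  - by apply/measurable_EFinP; exact: mcD.
  - by move=> r /posI r0; rewrite lee_fin !mulr_ge0 // ltW.
  apply: leeD2l; rewrite ge0_integralD //; first last.
  - exact: mI.
  - by move=> r /posI r0; rewrite lee_fin mulr_ge0 // rhs_weight_ge0 // ltW.
  - by apply/measurable_EFinP; exact: mcD.
  - by move=> r /posI r0; rewrite lee_fin !mulr_ge0 // ltW.
  rewrite restr //; apply: leeD2r; apply: ge0_subset_integral => //.
    by apply/measurable_EFinP; exact: mcD.
  by move=> r /posI r0; rewrite lee_fin !mulr_ge0 // ltW.
apply: ge0_le_integral_nonmeas => r rI; have r0 := posI r rI.
  have X0 : 0 <= \1_E r * rhs_weight S w r by apply: mulr_ge0 => //; exact: rhs_weight_ge0 (ltW r0).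
  rewrite -!EFinD lee_fin; apply: addr_ge0; last apply: addr_ge0 => //.
    by apply: mulr_ge0; [exact: mulr_ge0|exact: ltW].
  by apply: mulr_ge0; [exact: mulr_ge0|exact: ltW].
rewrite -!EFinD lee_fin -/(D r) -/(w r).
have -> : (1 - kappa) * D r * r + (kappa * D r * r + \1_E r * rhs_weight S w r) =
    D r * r + \1_E r * rhs_weight S w r by ring.
rewrite [leRHS]mulrDl lerD2l /rhs_weight.
rewrite mulrA; apply: ler_wpM2r; first exact: ltW.
rewrite mulrA; apply: ler_wpM2r => //.
rewrite mulrA; apply: ler_wpM2r; first by rewrite invr_ge0 sqr_ge0.
rewrite indicE; case: (boolP (r \in E)) => [|_]; last by rewrite mul0r rho_ge0.
by rewrite inE mul1r => /Er.
Qed.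

End Cells.

(** This serves point fluxes and the degenerate case [alphaN = 0], in which the integrands
    themselves can be compared. *)
Lemma rhs_le_lhs_pointwise (alpha q L kappa c : R) (N : nat) (y : 'I_(N - 2) -> R * R)
    (u1 u2 du1 du2 : R -> R) : 0 <= q -> 0 <= kappa <= 1 ->
  (forall r, q <= r -> c ^+ 2 * alphaN alpha N ^+ 2 <= rho alpha q y r) ->
  (rhs alpha q L kappa c N u1 u2 du1 du2 <= lhs alpha q L y u1 u2 du1 du2)%E.
Proof.
move=> q0 /andP[k0 k1] h; apply: ge0_le_integral_nonmeas => r;
  rewrite /= in_itv/= => /andP[qr _]; have r0 : 0 <= r := le_trans q0 qr.
  have k10 : 0 <= 1 - kappa by lra.
  rewrite lee_fin mulr_ge0 // addr_ge0 //; first by rewrite mulr_ge0 // addr_ge0 ?sqr_ge0.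
  apply: mulr_ge0; last by rewrite addr_ge0 ?sqr_ge0.
  apply: mulr_ge0; last by rewrite indicE ler0n.
  by apply: divr_ge0; [apply: mulr_ge0|]; exact: sqr_ge0.
rewrite lee_fin; apply: ler_wpM2r => //; apply: lerD.
  by rewrite ler_piMl ?addr_ge0 ?sqr_ge0 //; lra.
apply: ler_wpM2r; first by rewrite addr_ge0 ?sqr_ge0.
have i0 : 0 <= (r ^+ 2)^-1 by rewrite invr_ge0 sqr_ge0.
apply: (@le_trans _ _ (c ^+ 2 * alphaN alpha N ^+ 2 / r ^+ 2)).
  rewrite ler_piMr //; first by apply: mulr_ge0 => //; apply: mulr_ge0; exact: sqr_ge0.
by apply: ler_wpM2r => //; exact: h.
Qed.

End Assembly.

Theorem theorem4p1 (R : realType) (alpha : R) (N : nat) (y : 'I_(N - 2) -> R * R)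
    (Rr L kappa : R) (u1 u2 du1 du2 : R -> R) :
  (2 <= N)%N -> 0 < L -> 0 <= Rr -> Rr <= L / 6 -> 0 <= kappa <= 1 ->
  W12r Rr L u1 du1 -> W12r Rr L u2 du2 ->
  (rhs alpha Rr L kappa (ckappa kappa) N u1 u2 du1 du2
     <= lhs alpha Rr L y u1 u2 du1 du2)%E /\
  (Rr = 0 ->
   (rhs alpha Rr L kappa 1 N u1 u2 du1 du2 <= lhs alpha Rr L y u1 u2 du1 du2)%E).
Proof.
move=> _ _ R0 RL k01 W1 W2; split; last first.
  move=> RE; move: W1 W2; rewrite RE => _ _; apply: rhs_le_lhs_pointwise => // r _.
  by rewrite expr1n mul1r rho_ge_point.
(* The cell argument works with a positive distance [alphaN / 640]; if [alphaN] vanishes, only the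
   gradient term remains on the right. *)
have [A0|A0] := ltP 0 (alphaN alpha N); last first.
  apply: rhs_le_lhs_pointwise => // r _.
  have -> : alphaN alpha N = 0 by apply/eqP; rewrite eq_le A0 alphaN_ge0.
  by rewrite [0 ^+ 2]expr0n mulr0 rho_ge0.
move: R0; rewrite le_eqVlt => /predU1P[RE|R0]; last exact: rhs_le_lhs_extended.
(* For point fluxes [rho] dominates [alphaN ^+ 2] everywhere, and the square of [ckappa kappa] is at
   most 1. *)
rewrite -RE; apply: rhs_le_lhs_pointwise => // r _.
apply: le_trans (rho_ge_point _ _ _); rewrite ler_piMl ?sqr_ge0 //.
have [_ h] := ckappa_sqr_le k01; case/andP: k01 => _ ?; lra.
Qed.
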